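(* Let $A, B \in \mathcal{S}$ (standard generating sets) and suppose they have the same signature, i.e. $|A|=|B|$ and the order-preserving bijection $\theta: A\to B$ (with respect to the orders $<$ on $A$ and $B$) satisfies $o(\theta(f),\theta(g)) = o(f,g)$ for all $f<g$ in $A$. Then $\theta$ extends to a group isomorphism from $\langle A\rangle$ to $\langle B\rangle$.
   Context: $\mathrm{Homeo}_+(I)$ is the group of orientation-preserving homeomorphisms of $I=[0,1]$, acting on the right ($t\mapsto tf$) and composed left to right; $f^g = g^{-1}fg$. The support of $f$ is $\mathrm{supt}(f)=\{t: tf\neq t\}$; its extended support is the interior of the closure of $\mathrm{supt}(f)$. An orbital of $f$ is a connected component of $\mathrm{supt}(f)$; endpoints of orbitals are transition points of $f$. A bump is an element with exactly one orbital; it is positive if $tf>t$ on its orbital, negative otherwise. If $J$ is an orbital of $g$, the bump of $g$ on $J$ agrees with $g$ on $J$ and is the identity elsewhere. A marking of a set of bumps assigns to each bump $a$ with support $(u,v)$ a point $s_a\in(u,v)$; the feet of $a$ are $(u,s_a)$ and $[t_a,v)$ where $t_a=s_a a$ if $a$ is positive and $t_a=s_a a^{-1}$ if $a$ is negative. A marked function is an element of $\mathrm{Homeo}_+(I)$ with finitely many bumps together with a marking of its bumps. A finite set $S$ of marked functions is fast if no bump occurs in two different elements of $S$ and distinct bumps occurring in $S$ have disjoint feet. A standard function is a marked function $f$ whose extended support is an interval, all of whose positive bumps lie to the right of all its negative bumps, and whose number of positive bumps equals or exceeds by one its number of negative bumps. For standard $f,g$: $f\ll g$ means their extended supports are disjoint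 with that of $f$ to the left; $f\sqsubset g$ means the closure of the extended support of $f$ lies in the extended support of $g$; $f<g$ means $f\ll g$ or $f\sqsubset g$. For standard $f$, $f^\circ$ is defined as follows: if $f$ has more than two orbitals, $f^\circ$ agrees with $f$ on the union of all orbitals of $f$ other than its leftmost and rightmost, is the identity elsewhere, and keeps the markers of $f$; if $f$ has one or two orbitals and the left foot of its positive bump is $(r,s)$, $f^\circ$ is a positive bump with support $(r,s)$ and arbitrary marker. A pair $(f,g)$ of standard functions is a standard pair if $\{f,g\}$ is fast and either $f\ll g$, or $f\sqsubset g$ and $(g^\circ,f)$ is a standard pair (recursive definition). $\mathcal{S}$ is the collection of finite sets $A$ of standard functions such that any two distinct elements of $A$ are $<$-comparable and, written $f<g$, form a standard pair. For a fast pair $f<g$ of marked functions, the oscillation $o(f,g)$ is the number of orbitals of $g$ containing at least one transition point of $f$. *)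

(* Defs.v *)
From Stdlib Require Import Reals List Sorting.Sorted Permutation.
Import ListNotations.
Open Scope R_scope.

(** * Homeo_+(I)
   An element of Homeo_+([0,1]) is encoded as a function R -> R which is
   continuous, strictly increasing and is the identity outside (0,1).
   (Restriction to [0,1] is a bijection with Homeo_+(I).)
   Composition is left to right: [hcomp f g] = "first f, then g", i.e.
   t (fg) = (tf) g. *)
Definition is_homeo (f : R -> R) : Prop :=
  continuity f /\
  (forall x y, x < y -> f x < f y) /\
  (forall x, (x <= 0 \/ 1 <= x) -> f x = x).

Definition hcomp (f g : R -> R) : R -> R := fun t => g (f t).

Definition supt (f : R -> R) (t : R) : Prop := f t <> t.

Definition is_orbital (f : R -> R) (u v : R) : Prop :=
  u < v /\ f u = u /\ f v = v /\ (forall t, u < t < v -> f t <> t).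

Definition closure (S : R -> Prop) (x : R) : Prop :=
  forall eps, 0 < eps -> exists y, S y /\ Rabs (y - x) < eps.
Definition interior (S : R -> Prop) (x : R) : Prop :=
  exists eps, 0 < eps /\ forall y, Rabs (y - x) < eps -> S y.
Definition ext_supp (f : R -> R) : R -> Prop := interior (closure (supt f)).

(** * Marked functions
   A bump datum is a triple ((u, s), v): an orbital (u,v) with marker s. *)
Definition bdatum := (R * R * R)%type.
Definition bu (b : bdatum) : R := fst (fst b).
Definition bs (b : bdatum) : R := snd (fst b).
Definition bv (b : bdatum) : R := snd b.

Record marked := Mk { mfun : R -> R ; mbumps : list bdatum }.

Definition valid_marked (m : marked) : Prop :=
  is_homeo (mfun m) /\
  StronglySorted (fun b c => bu b < bu c) (mbumps m) /\
  (forall b, In b (mbumps m) ->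
     is_orbital (mfun m) (bu b) (bv b) /\ bu b < bs b < bv b) /\
  (forall u v, is_orbital (mfun m) u v -> exists s, In ((u, s), v) (mbumps m)).

Definition in_open_b (u v t : R) : bool :=
  if Rlt_dec u t then (if Rlt_dec t v then true else false) else false.
Definition bump_of (f : R -> R) (u v : R) : R -> R :=
  fun t => if in_open_b u v t then f t else t.

Definition pos_on (f : R -> R) (b : bdatum) : Prop :=
  forall t, bu b < t < bv b -> f t > t.
Definition neg_on (f : R -> R) (b : bdatum) : Prop :=
  forall t, bu b < t < bv b -> f t < t.

(** feet of a marked bump (a, support (u,v), marker s):
    left foot (u,s); right foot [t_a, v) with t_a = s a if a positive,
    t_a = s a^{-1} if a negative (so t_a <= x iff s <= x a). *)
Definition left_foot (b : bdatum) (x : R) : Prop := bu b < x < bs b.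
Definition right_foot (a : R -> R) (b : bdatum) (x : R) : Prop :=
  (pos_on a b -> a (bs b) <= x /\ x < bv b) /\
  (neg_on a b -> bs b <= a x /\ x < bv b).
Definition feet (a : R -> R) (b : bdatum) (x : R) : Prop :=
  left_foot b x \/ right_foot a b x.

Definition fast (S : list marked) : Prop :=
  (forall f g b c, In f S -> In g S -> f <> g ->
     In b (mbumps f) -> In c (mbumps g) ->
     bump_of (mfun f) (bu b) (bv b) <> bump_of (mfun g) (bu c) (bv c)) /\
  (forall f g b c, In f S -> In g S ->
     In b (mbumps f) -> In c (mbumps g) ->
     (bump_of (mfun f) (bu b) (bv b), bs b) <>
       (bump_of (mfun g) (bu c) (bv c), bs c) ->
     forall x, ~ (feet (bump_of (mfun f) (bu b) (bv b)) b x /\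
                  feet (bump_of (mfun g) (bu c) (bv c)) c x)).

Definition is_interval (S : R -> Prop) : Prop :=
  (exists x, S x) /\ (forall x y z, x < y < z -> S x -> S z -> S y).

Definition standard (f : marked) : Prop :=
  valid_marked f /\
  is_interval (ext_supp (mfun f)) /\
  (forall b c, In b (mbumps f) -> In c (mbumps f) ->
     pos_on (mfun f) b -> neg_on (mfun f) c -> bv c <= bu b) /\
  (exists lp ln, Permutation.Permutation (mbumps f) (lp ++ ln) /\
     (forall b, In b lp -> pos_on (mfun f) b) /\
     (forall b, In b ln -> neg_on (mfun f) b) /\
     (length lp = length ln \/ length lp = S (length ln))%nat).

Definition ll (f g : marked) : Prop :=
  forall x y, ext_supp (mfun f) x -> ext_supp (mfun g) y -> x < y.
Definition sqsub (f g : marked) : Prop :=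
  forall x, closure (ext_supp (mfun f)) x -> ext_supp (mfun g) x.
Definition slt (f g : marked) : Prop := ll f g \/ sqsub f g.

(** f° (relation [circ f h]: h is a possible value of f°) *)
Definition middle (l : list bdatum) : list bdatum := removelast (tl l).
Definition circ (f h : marked) : Prop :=
  valid_marked h /\
  (((2 < length (mbumps f))%nat /\
    mbumps h = middle (mbumps f) /\
    (forall t, mfun h t =
       if existsb (fun b => in_open_b (bu b) (bv b) t) (middle (mbumps f))
       then mfun f t else t))
   \/
   ((length (mbumps f) = 1 \/ length (mbumps f) = 2)%nat /\
    exists b, In b (mbumps f) /\ pos_on (mfun f) b /\
    exists c, mbumps h = [c] /\ bu c = bu b /\ bv c = bs b /\
              pos_on (mfun h) c)).

Inductive std_pair : marked -> marked -> Prop :=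
| SP_ll : forall f g, standard f -> standard g -> fast [f; g] -> ll f g ->
    std_pair f g
| SP_sq : forall f g h, standard f -> standard g -> fast [f; g] -> sqsub f g ->
    circ g h -> std_pair h f -> std_pair f g.

Definition in_S (A : list marked) : Prop :=
  NoDup A /\ (forall f, In f A -> standard f) /\
  (forall f g, In f A -> In g A -> f <> g -> slt f g \/ slt g f) /\
  (forall f g, In f A -> In g A -> f <> g -> slt f g -> std_pair f g).

Definition transition_points (f : marked) : list R :=
  flat_map (fun b => [bu b; bv b]) (mbumps f).
Definition osc (f g : marked) : nat :=
  length (filter (fun c => existsb (fun w => in_open_b (bu c) (bv c) w)
                                   (transition_points f))
                 (mbumps g)).

Inductive gen (A : list marked) : (R -> R) -> Prop :=
| gen_id : gen A (fun t => t)
| gen_base : forall f, In f A -> gen A (mfun f)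
| gen_comp : forall h k, gen A h -> gen A k -> gen A (hcomp h k)
| gen_inv : forall h k, gen A h -> (forall t, k (h t) = t) ->
    (forall t, h (k t) = t) -> gen A k.

(* Main.v *)
(* A standard function pushes the points of each of its bumps towards the outer end of that
   bump, and a standard pair [f < g] is a chain of nested extended supports of the functions
   obtained from [f] and [g] by peeling.  Hence the oscillation [k] of the pair alone determines,
   for the bumps numbered from the outside in, which bump of [g] contains a given end of [f]
   and conversely: the [q]-th end of [f] lies in bump [min q k] of [g], and the [q]-th end of
   [g] in bump [min (q - 2) (k - 1)] of [f].  Feet are disjoint, so a foot lies in the same
   bumps of the other functions as the end it touches.

   Ping-pong then transfers relations.  The history of a point is the sequence of letters
   undone while the point stays in feet; a letter changes a history by pushing or popping.
   If a word [w] moves some point in the second family, then, since an infinite orbit of [w]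
   cannot consist of points with short histories, it moves one whose history is longer than
   [w].  A point of the first family whose history starts with the same labels behaves in the
   same way along [w] and is therefore moved too.  Bumps of [g] that exist in one family only
   contain no end of any other function; a point of such a bump is imitated by a point lying
   deep in the inner foot of the innermost bump of the other family. *)

Require Import Defs.
From Stdlib Require Import Reals List Lra Lia Sorting.Sorted Permutation Arith ZArith ZifyNat.
From Stdlib Require Import Classical ClassicalEpsilon FunctionalExtensionality.
Import ListNotations.
Open Scope R_scope.

Ltac Zify.zify_post_hook ::= Z.to_euclidean_division_equations.

(** * The orbitals of a standard function *)

Lemma continuity_nonzero_nbhd (d : R -> R) (x : R) :
  continuity d -> d x <> 0 ->
  exists del, 0 < del /\ forall y, Rabs (y - x) < del -> d y <> 0.
Proof.
  intros Hc Hx.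
  destruct (Hc x (Rabs (d x)) (Rabs_pos_lt _ Hx)) as [del [Hd H]].
  exists del; split; [exact Hd|]; intros y Hy E.
  destruct (Req_dec y x) as [->|Hne]; [contradiction|].
  assert (Hy' : R_dist (d y) (d x) < Rabs (d x)).
  { apply H; repeat split; auto. }
  unfold R_dist in Hy'; rewrite E, Rminus_0_l, Rabs_Ropp in Hy'; lra.
Qed.

(** The supremum [u] of the zeros up to [t] is itself a zero: a zero-free neighbourhood of [u] would
    give a smaller upper bound. *)
Lemma last_zero_before (d : R -> R) (a t : R) :
  continuity d -> a < t -> d a = 0 -> d t <> 0 ->
  exists u, u < t /\ d u = 0 /\ forall x, u < x <= t -> d x <> 0.
Proof.
  intros Hc Hat Ha Ht.
  destruct (completeness (fun x => x <= t /\ d x = 0)) as [u [Hub Hlub]].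
  - exists t; intros x [Hx _]; exact Hx.
  - exists a; split; [lra|exact Ha].
  - assert (Hut : u <= t) by (apply Hlub; intros x [Hx _]; exact Hx).
    assert (Hu : d u = 0).
    { apply NNPP; intro Hne.
      destruct (continuity_nonzero_nbhd d u Hc Hne) as [del [Hd H]].
      assert (u <= u - del / 2); [|lra].
      apply Hlub; intros x [Hx E].
      destruct (Rle_dec x (u - del / 2)) as [|Hgt]; [assumption|exfalso].
      apply (H x); [|exact E].
      assert (x <= u) by (apply Hub; split; assumption).
      apply Rabs_def1; lra. }
    exists u; repeat split.
    + destruct Hut as [|E]; [assumption|subst; contradiction].
    + exact Hu.
    + intros x [Hx Hx'] E; assert (x <= u) by (apply Hub; split; assumption); lra.
Qed.

Lemma orbital_around (f : R -> R) (t : R) :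
  is_homeo f -> f t <> t -> exists u v, is_orbital f u v /\ u < t < v.
Proof.
  intros [Hc [Hinc Hid]] Ht.
  assert (H01 : 0 < t < 1).
  { destruct (Rle_dec t 0); [destruct Ht; apply Hid; lra|].
    destruct (Rle_dec 1 t); [destruct Ht; apply Hid; lra|lra]. }
  assert (Hd : continuity (fun x => f x - x)).
  { apply (continuity_minus f id); [exact Hc|].
    apply derivable_continuous, derivable_id. }
  destruct (last_zero_before (fun x => f x - x) 0 t) as [u [Hu [Eu Nu]]];
    [exact Hd|lra|rewrite Hid; lra|lra|].
  (* The right end of the orbital comes from the same lemma after reflecting the line; [-1] is the
     reflected fixed point 1. *)
  destruct (last_zero_before (fun x => f (- x) - (- x)) (-1) (- t)) as [v [Hv [Ev Nv]]].
  - apply (continuity_comp (fun x => - x) (fun x => f x - x)); [|exact Hd].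
    apply (continuity_opp id), derivable_continuous, derivable_id.
  - lra.
  - rewrite Hid; lra.
  - rewrite Ropp_involutive; lra.
  - exists u, (- v); repeat split; try lra.
    intros x Hx E. destruct (Rle_dec x t).
    + apply (Nu x); lra.
    + apply (Nv (- x)); [lra|]. rewrite Ropp_involutive; lra.
Qed.

Lemma homeo_surj (f : R -> R) (y : R) : is_homeo f -> exists x, f x = y.
Proof.
  intros [Hc [Hinc Hid]].
  destruct (Rle_dec y 0); [exists y; apply Hid; lra|].
  destruct (Rle_dec 1 y); [exists y; apply Hid; lra|].
  destruct (IVT (fun x => f x - y) 0 1) as [z [_ Hz]].
  - apply (continuity_minus f (fun _ => y)); [exact Hc|].
    apply continuity_const; intros ? ?; reflexivity.
  - lra.
  - rewrite Hid; lra.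
  - rewrite Hid; lra.
  - exists z; lra.
Qed.

Definition nb (f : marked) : nat := length (mbumps f).
Definition bmp (f : marked) (i : nat) : bdatum := nth i (mbumps f) ((0, 0), 0).
(** Consecutive bumps of a standard function share an end, so [pt f 0], ..., [pt f (nb f)] are all
    its transition points and bump [i] runs from [pt f i] to [pt f (S i)]. *)
Definition pt (f : marked) (i : nat) : R :=
  match i with O => bu (bmp f 0) | S j => bv (bmp f j) end.
Definition mk (f : marked) (i : nat) : R := bs (bmp f i).

Lemma bmp_In f i : (i < nb f)%nat -> In (bmp f i) (mbumps f).
Proof. intros H; apply nth_In, H. Qed.

Lemma In_bmp f b : In b (mbumps f) -> exists i, (i < nb f)%nat /\ b = bmp f i.
Proof.
  intros H; destruct (In_nth _ _ ((0, 0), 0) H) as [i [Hi E]].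
  exists i; split; [exact Hi|symmetry; exact E].
Qed.

Lemma StronglySorted_nth {X : Type} (lt : X -> X -> Prop) (d : X) (l : list X) :
  StronglySorted lt l ->
  forall i j, (i < j < length l)%nat -> lt (nth i l d) (nth j l d).
Proof.
  induction 1 as [|a l Hs IH Hf]; simpl; intros i j Hij; [lia|].
  destruct j as [|j]; [lia|]; destruct i as [|i].
  - rewrite Forall_forall in Hf; apply Hf, nth_In; lia.
  - apply IH; lia.
Qed.

Section Valid.
Variable f : marked.
Hypothesis Hv : valid_marked f.

Lemma bmp_orbital i : (i < nb f)%nat -> is_orbital (mfun f) (bu (bmp f i)) (bv (bmp f i)).
Proof. intros H; apply (proj1 (proj2 (proj2 Hv))), bmp_In, H. Qed.

Lemma bmp_marker i : (i < nb f)%nat -> bu (bmp f i) < mk f i < bv (bmp f i).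
Proof. intros H; apply (proj1 (proj2 (proj2 Hv))), bmp_In, H. Qed.

Lemma bu_increasing i j : (i < j < nb f)%nat -> bu (bmp f i) < bu (bmp f j).
Proof.
  intros H. apply (StronglySorted_nth (fun b c => bu b < bu c)); [apply Hv|exact H].
Qed.

Lemma bmp_disjoint i j : (i < j < nb f)%nat -> bv (bmp f i) <= bu (bmp f j).
Proof.
  intros H; apply Rnot_lt_le; intro Hlt.
  destruct (bmp_orbital i ltac:(lia)) as [_ [_ [_ Hi]]].
  destruct (bmp_orbital j ltac:(lia)) as [_ [Ej _]].
  apply (Hi (bu (bmp f j))); [|exact Ej].
  split; [apply bu_increasing, H|exact Hlt].
Qed.

Lemma supt_bmp t : mfun f t <> t ->
  exists i, (i < nb f)%nat /\ bu (bmp f i) < t < bv (bmp f i).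
Proof.
  intros Ht. destruct (orbital_around _ t (proj1 Hv) Ht) as [u [v [Ho Htuv]]].
  destruct (proj2 (proj2 (proj2 Hv)) u v Ho) as [s Hs].
  destruct (In_bmp _ _ Hs) as [i [Hi E]].
  exists i; split; [exact Hi|rewrite <- E; exact Htuv].
Qed.

Lemma bmp_supt i t : (i < nb f)%nat -> bu (bmp f i) < t < bv (bmp f i) -> supt (mfun f) t.
Proof. intros Hi Ht; apply (bmp_orbital i Hi), Ht. Qed.

Lemma bmp_ext i x : (i < nb f)%nat -> bu (bmp f i) < x < bv (bmp f i) -> ext_supp (mfun f) x.
Proof.
  intros Hi Hx. exists (Rmin (x - bu (bmp f i)) (bv (bmp f i) - x)); split.
  - apply Rmin_glb_lt; lra.
  - intros y Hy eps Heps. exists y; split.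
    + apply (bmp_supt i y Hi).
      pose proof (Rmin_l (x - bu (bmp f i)) (bv (bmp f i) - x)).
      pose proof (Rmin_r (x - bu (bmp f i)) (bv (bmp f i) - x)).
      apply Rabs_def2 in Hy; lra.
    + rewrite Rminus_diag, Rabs_R0; exact Heps.
Qed.

End Valid.

Section Standard.
Variable f : marked.
Hypothesis Hf : standard f.

Lemma nb_pos : (1 <= nb f)%nat.
Proof.
  destruct (Hf) as [_ [[[x Hx] _] _]].
  destruct (Nat.eq_dec (nb f) 0) as [E|]; [exfalso|lia].
  destruct Hx as [eps [Heps Hx]].
  destruct (Hx x) with (eps := 1) as [y [Hy _]];
    [rewrite Rminus_diag, Rabs_R0; exact Heps|lra|].
  destruct (supt_bmp f (proj1 Hf) y Hy) as [i [Hi _]]; lia.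
Qed.

(* A gap between consecutive bumps would disconnect the extended support. *)
Lemma bmp_contiguous i : (S i < nb f)%nat -> bv (bmp f i) = bu (bmp f (S i)).
Proof.
  intros Hi. apply Rle_antisym; [apply bmp_disjoint; [exact (proj1 Hf)|lia]|].
  apply Rnot_lt_le; intro Hgap.
  pose proof (bmp_marker f (proj1 Hf) i ltac:(lia)) as H1.
  pose proof (bmp_marker f (proj1 Hf) (S i) ltac:(lia)) as H2.
  set (y := (bv (bmp f i) + bu (bmp f (S i))) / 2).
  assert (Hy : ext_supp (mfun f) y).
  { destruct (Hf) as [_ [[_ Hint] _]].
    apply (Hint (mk f i) y (mk f (S i))).
    - unfold y; lra.
    - apply (bmp_ext f (proj1 Hf) i); [lia|lra].
    - apply (bmp_ext f (proj1 Hf) (S i)); [lia|lra]. }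
  destruct Hy as [eps [Heps Hy]].
  destruct (Hy y) with (eps := (bu (bmp f (S i)) - bv (bmp f i)) / 2) as [z [Hz Hzy]].
  - rewrite Rminus_diag, Rabs_R0; exact Heps.
  - lra.
  - apply Rabs_def2 in Hzy.
    destruct (supt_bmp f (proj1 Hf) z Hz) as [j [Hj Hzj]].
    destruct (le_lt_dec j i) as [Hji|Hji].
    + assert (bv (bmp f j) <= bv (bmp f i)).
      { destruct (Nat.eq_dec j i) as [->|]; [lra|].
        pose proof (bmp_disjoint f (proj1 Hf) j i ltac:(lia)); lra. }
      unfold y in *; lra.
    + assert (bu (bmp f (S i)) <= bu (bmp f j)).
      { destruct (Nat.eq_dec j (S i)) as [->|]; [lra|].
        pose proof (bu_increasing f (proj1 Hf) (S i) j ltac:(lia)); lra. }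
      unfold y in *; lra.
Qed.

Lemma bu_pt i : (i < nb f)%nat -> bu (bmp f i) = pt f i.
Proof.
  destruct i; intros H; [reflexivity|]. symmetry; apply bmp_contiguous, H.
Qed.

Lemma pt_mk i : (i < nb f)%nat -> pt f i < mk f i < pt f (S i).
Proof. intros H; rewrite <- bu_pt by exact H; exact (bmp_marker f (proj1 Hf) i H). Qed.

Lemma pt_lt i j : (i < j <= nb f)%nat -> pt f i < pt f j.
Proof.
  intros [H1 H2]. induction H1 as [|j H1 IH].
  - pose proof (pt_mk i ltac:(lia)); lra.
  - pose proof (pt_mk j ltac:(lia)); pose proof (IH ltac:(lia)); lra.
Qed.

Lemma pt_le i j : (i <= j <= nb f)%nat -> pt f i <= pt f j.
Proof.
  intros H; destruct (Nat.eq_dec i j) as [->|]; [lra|].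
  pose proof (pt_lt i j ltac:(lia)); lra.
Qed.

Lemma pt_fixed i : (i <= nb f)%nat -> mfun f (pt f i) = pt f i.
Proof.
  pose proof nb_pos. destruct i; intros Hi; apply (bmp_orbital f (proj1 Hf)); lia.
Qed.

Lemma supt_pt t : mfun f t <> t -> exists i, (i < nb f)%nat /\ pt f i < t < pt f (S i).
Proof.
  intros H; destruct (supt_bmp f (proj1 Hf) t H) as [i [Hi Ht]].
  exists i; rewrite <- bu_pt by exact Hi; split; assumption.
Qed.

Lemma ext_supp_pt x : ext_supp (mfun f) x <-> pt f 0 < x < pt f (nb f).
Proof.
  pose proof nb_pos as Hpos. split.
  - intros [eps [Heps Hx]].
    assert (Hnear : forall y, Rabs (y - x) < eps -> pt f 0 <= y <= pt f (nb f)).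
    { intros y Hy; split; apply Rnot_lt_le; intro Hlt.
      - destruct (Hx y Hy (pt f 0 - y)) as [z [Hz Hzy]]; [lra|].
        apply Rabs_def2 in Hzy.
        destruct (supt_pt z Hz) as [i [Hi Hzi]].
        pose proof (pt_le 0 i ltac:(lia)); lra.
      - destruct (Hx y Hy (y - pt f (nb f))) as [z [Hz Hzy]]; [lra|].
        apply Rabs_def2 in Hzy.
        destruct (supt_pt z Hz) as [i [Hi Hzi]].
        pose proof (pt_le (S i) (nb f) ltac:(lia)); lra. }
    (* Weak bounds at distance [eps / 2] on both sides of [x] give strict bounds at [x]. *)
    pose proof (Hnear (x - eps / 2)) as Hl. pose proof (Hnear (x + eps / 2)) as Hr.
    replace (x - eps / 2 - x) with (- (eps / 2)) in Hl by ring.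
    replace (x + eps / 2 - x) with (eps / 2) in Hr by ring.
    rewrite Rabs_Ropp in Hl. rewrite Rabs_right in Hl, Hr by lra.
    specialize (Hl ltac:(lra)); specialize (Hr ltac:(lra)); lra.
  - intros Hx.
    (* Induction over the bumps from the left. A point that may be a shared end is approximated by
       points slightly to its right, inside the next bump. *)
    assert (Hcl : forall n y, (n <= nb f)%nat -> pt f 0 < y < pt f n ->
              closure (supt (mfun f)) y).
    { induction n as [|n IH]; intros y Hn Hy; [lra|].
      pose proof (pt_lt n (S n) ltac:(lia)) as Hlt.
      destruct (Rlt_dec y (pt f n)) as [|Hge]; [apply IH; [lia|lra]|].
      intros eps Heps.
      set (d := Rmin (eps / 2) ((pt f (S n) - y) / 2)).
      assert (Hd : 0 < d) by (apply Rmin_glb_lt; lra).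
      pose proof (Rmin_l (eps / 2) ((pt f (S n) - y) / 2)) as Hd1.
      pose proof (Rmin_r (eps / 2) ((pt f (S n) - y) / 2)) as Hd2.
      fold d in Hd1, Hd2.
      exists (y + d); split.
      - apply (bmp_supt f (proj1 Hf) n); [lia|]. rewrite bu_pt by lia.
        change (bv (bmp f n)) with (pt f (S n)); lra.
      - replace (y + d - y) with d by ring; rewrite Rabs_right; lra. }
    exists (Rmin (x - pt f 0) (pt f (nb f) - x)); split; [apply Rmin_glb_lt; lra|].
    intros y Hy. apply (Hcl (nb f)); [lia|].
    pose proof (Rmin_l (x - pt f 0) (pt f (nb f) - x)).
    pose proof (Rmin_r (x - pt f 0) (pt f (nb f) - x)).
    apply Rabs_def2 in Hy; lra.
Qed.

Lemma bmp_inj i j : (i < nb f)%nat -> (j < nb f)%nat -> bmp f i = bmp f j -> i = j.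
Proof.
  intros Hi Hj E. destruct (Nat.lt_total i j) as [H|[H|H]]; [exfalso|exact H|exfalso].
  - pose proof (bu_increasing f (proj1 Hf) i j ltac:(lia)) as Hlt; rewrite E in Hlt; lra.
  - pose proof (bu_increasing f (proj1 Hf) j i ltac:(lia)) as Hlt; rewrite E in Hlt; lra.
Qed.

Lemma mbumps_NoDup : NoDup (mbumps f).
Proof.
  apply (NoDup_nth (mbumps f) ((0, 0), 0)); intros i j Hi Hj; apply bmp_inj; assumption.
Qed.

(** Counting: if a bump in the right half were negative, all positive bumps would lie to its right,
    where there is too little room; symmetrically on the left. *)
Lemma bmp_sign i : (i < nb f)%nat ->
  ((nb f / 2 <= i)%nat -> pos_on (mfun f) (bmp f i)) /\
  ((i < nb f / 2)%nat -> neg_on (mfun f) (bmp f i)).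
Proof.
  intros Hi. destruct (Hf) as [_ [_ [Hsep [lp [ln [Hperm [Hp [Hn Hlen]]]]]]]].
  assert (Hsum : nb f = (length lp + length ln)%nat)
    by (unfold nb; rewrite (Permutation_length Hperm), length_app; reflexivity).
  assert (Hnd : NoDup (lp ++ ln)) by (apply (Permutation_NoDup Hperm), mbumps_NoDup).
  assert (Hdec : forall b, In b (mbumps f) -> In b lp \/ In b ln).
  { intros b Hb; apply in_app_or, (Permutation_in _ Hperm), Hb. }
  assert (Hin : forall b, In b lp \/ In b ln -> In b (mbumps f)).
  { intros b Hb; apply (Permutation_in _ (Permutation_sym Hperm)), in_or_app, Hb. }
  assert (Hord : forall j k, (j < nb f)%nat -> (k < nb f)%nat -> In (bmp f j) lp ->
             In (bmp f k) ln -> (k < j)%nat).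
  { intros j k Hj Hk Ij Ik.
    assert (Hle : bv (bmp f k) <= bu (bmp f j))
      by (apply Hsep; [apply bmp_In, Hj|apply bmp_In, Hk|apply Hp, Ij|apply Hn, Ik]).
    apply Nat.nle_gt; intro Hjk.
    pose proof (bmp_marker f (proj1 Hf) k Hk).
    assert (bu (bmp f j) <= bu (bmp f k)); [|lra].
    destruct (Nat.eq_dec j k) as [->|]; [lra|].
    pose proof (bu_increasing f (proj1 Hf) j k ltac:(lia)); lra. }
  split; intros Hhalf.
  - destruct (Hdec _ (bmp_In f i Hi)) as [|In_i]; [apply Hp; assumption|exfalso].
    assert (Hincl : incl lp (map (bmp f) (seq (S i) (nb f - S i)))).
    { intros b Hb. destruct (In_bmp f b (Hin b (or_introl Hb))) as [j [Hj ->]].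
      apply in_map, in_seq. pose proof (Hord j i Hj Hi Hb In_i); lia. }
    apply NoDup_incl_length in Hincl; [|eapply NoDup_app_remove_r; exact Hnd].
    rewrite length_map, length_seq in Hincl; lia.
  - destruct (Hdec _ (bmp_In f i Hi)) as [In_i|]; [exfalso|apply Hn; assumption].
    assert (Hincl : incl ln (map (bmp f) (seq 0 i))).
    { intros b Hb. destruct (In_bmp f b (Hin b (or_intror Hb))) as [j [Hj ->]].
      apply in_map, in_seq. pose proof (Hord i j Hi Hj In_i Hb); lia. }
    apply NoDup_incl_length in Hincl; [|eapply NoDup_app_remove_l; exact Hnd].
    rewrite length_map, length_seq in Hincl; lia.
Qed.

Lemma mfun_above i t : (nb f / 2 <= i < nb f)%nat -> pt f i < t < pt f (S i) -> t < mfun f t.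
Proof.
  intros Hi Ht. apply Rgt_lt, (proj1 (bmp_sign i ltac:(lia)) ltac:(lia)).
  rewrite bu_pt by lia; exact Ht.
Qed.

Lemma mfun_below i t : (i < nb f / 2)%nat -> pt f i < t < pt f (S i) -> mfun f t < t.
Proof.
  intros Hi Ht. pose proof nb_pos.
  apply (proj2 (bmp_sign i ltac:(lia)) ltac:(lia)).
  rewrite bu_pt by lia; exact Ht.
Qed.

Lemma mfun_lt x y : x < y -> mfun f x < mfun f y.
Proof. apply Hf. Qed.

Lemma mfun_interval i t : (i < nb f)%nat ->
  pt f i < t < pt f (S i) <-> pt f i < mfun f t < pt f (S i).
Proof.
  intros Hi. pose proof (pt_fixed i ltac:(lia)) as E1.
  pose proof (pt_fixed (S i) ltac:(lia)) as E2.
  assert (Hlt : forall x y, x < y <-> mfun f x < mfun f y).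
  { intros x y; split; [apply mfun_lt|]. intros H.
    destruct (Rtotal_order x y) as [|[->|H']]; [assumption|lra|].
    apply mfun_lt in H'; lra. }
  rewrite (Hlt (pt f i) t), (Hlt t (pt f (S i))), E1, E2; tauto.
Qed.

End Standard.

(** * The order in terms of the ends of the extended supports *)

Lemma standard_ll f g : standard f -> standard g -> ll f g -> pt f (nb f) <= pt g 0.
Proof.
  intros Hf Hg H. apply Rnot_lt_le; intro Hlt.
  pose proof (pt_lt f Hf 0 (nb f) ltac:(pose proof (nb_pos f Hf); lia)).
  pose proof (pt_lt g Hg 0 (nb g) ltac:(pose proof (nb_pos g Hg); lia)).
  pose proof (Rmax_l (pt f 0) (pt g 0)) as A1.
  pose proof (Rmax_r (pt f 0) (pt g 0)) as A2.
  assert (A3 : Rmax (pt f 0) (pt g 0) < pt f (nb f)) by (apply Rmax_lub_lt; lra).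
  (* [x] is in the extended support of [f] and beyond the left end of [g], so the extended support
     of [g] has a point to the left of [x]. *)
  set (x := (Rmax (pt f 0) (pt g 0) + pt f (nb f)) / 2).
  pose proof (Rmin_l (pt g (nb g)) x) as B1.
  pose proof (Rmin_r (pt g (nb g)) x) as B2.
  assert (B3 : pt g 0 < Rmin (pt g (nb g)) x)
    by (apply Rmin_glb_lt; unfold x; lra).
  assert (x < (pt g 0 + Rmin (pt g (nb g)) x) / 2); [|lra].
  apply H; apply ext_supp_pt; trivial; [unfold x|]; lra.
Qed.

Lemma standard_sqsub f g : standard f -> standard g -> sqsub f g ->
  pt g 0 < pt f 0 /\ pt f (nb f) < pt g (nb g).
Proof.
  intros Hf Hg H.
  pose proof (pt_lt f Hf 0 (nb f) ltac:(pose proof (nb_pos f Hf); lia)) as Hlt.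
  assert (Hcl : forall x, pt f 0 <= x <= pt f (nb f) -> closure (ext_supp (mfun f)) x).
  { intros x Hx eps Heps.
    (* A point is approximated from the side facing the midpoint [y]; a quarter of the length at
       most keeps the approximation inside. *)
    set (y := (pt f 0 + pt f (nb f)) / 2).
    set (d := Rmin (eps / 2) ((pt f (nb f) - pt f 0) / 4)).
    assert (Hd : 0 < d) by (apply Rmin_glb_lt; lra).
    pose proof (Rmin_l (eps / 2) ((pt f (nb f) - pt f 0) / 4)) as Hd1.
    pose proof (Rmin_r (eps / 2) ((pt f (nb f) - pt f 0) / 4)) as Hd2.
    fold d in Hd1, Hd2. destruct (Rle_dec x y).
    - exists (x + d); split; [apply (ext_supp_pt f Hf); unfold y in *; lra|].
      replace (x + d - x) with d by ring; rewrite Rabs_right; lra.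
    - exists (x - d); split; [apply (ext_supp_pt f Hf); unfold y in *; lra|].
      replace (x - d - x) with (- d) by ring; rewrite Rabs_Ropp, Rabs_right; lra. }
  pose proof (H (pt f 0) (Hcl (pt f 0) ltac:(lra))) as H1.
  pose proof (H (pt f (nb f)) (Hcl (pt f (nb f)) ltac:(lra))) as H2.
  rewrite (ext_supp_pt g Hg) in H1, H2; lra.
Qed.

(** * Feet *)

Definition lfoot (f : marked) (i : nat) (x : R) : Prop := pt f i < x < mk f i.
(** The sign of the bump is read off from its position [i]; for a negative bump, [t_a <= x] is
    written without the inverse as [mk f i <= mfun f x]. *)
Definition rfoot (f : marked) (i : nat) (x : R) : Prop :=
  x < pt f (S i) /\
  ((nb f / 2 <= i)%nat -> mfun f (mk f i) <= x) /\
  ((i < nb f / 2)%nat -> mk f i <= mfun f x).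

Lemma mfun_le f x y : standard f -> x <= y -> mfun f x <= mfun f y.
Proof.
  intros Hf [H| ->]; [apply Rlt_le, mfun_lt; assumption|lra].
Qed.

Lemma rfoot_inside f i x : standard f -> (i < nb f)%nat -> rfoot f i x ->
  mk f i < x < pt f (S i).
Proof.
  intros Hf Hi [H1 [H2 H3]]; split; [|exact H1].
  pose proof (pt_mk f Hf i Hi) as Hmk.
  destruct (le_lt_dec (nb f / 2) i) as [Hs|Hs].
  - pose proof (mfun_above f Hf i (mk f i) ltac:(lia) Hmk). specialize (H2 Hs); lra.
  - specialize (H3 Hs). apply Rnot_le_lt; intro Hle.
    pose proof (mfun_le f _ _ Hf Hle).
    pose proof (mfun_below f Hf i (mk f i) Hs Hmk). lra.
Qed.

Lemma feet_rfoot f i x : standard f -> (i < nb f)%nat -> lfoot f i x \/ rfoot f i x ->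
  feet (bump_of (mfun f) (bu (bmp f i)) (bv (bmp f i))) (bmp f i) x.
Proof.
  intros Hf Hi [H|H]; [left|right].
  - unfold left_foot; rewrite (bu_pt f Hf i Hi); exact H.
  - pose proof (rfoot_inside f i x Hf Hi H) as Hx.
    pose proof (pt_mk f Hf i Hi) as Hmk. destruct H as [H1 [H2 H3]].
    assert (Hb : forall t, pt f i < t < pt f (S i) ->
              bump_of (mfun f) (bu (bmp f i)) (bv (bmp f i)) t = mfun f t).
    { intros t Ht. unfold bump_of, in_open_b. rewrite (bu_pt f Hf i Hi).
      change (bv (bmp f i)) with (pt f (S i)).
      destruct (Rlt_dec (pt f i) t); [|lra].
      destruct (Rlt_dec t (pt f (S i))); [reflexivity|lra]. }
    assert (Hmk' : bu (bmp f i) < mk f i < bv (bmp f i))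
      by (rewrite (bu_pt f Hf i Hi); exact Hmk).
    (* The assumed sign is compared, at the marker, with the sign dictated by the position. *)
    split; intros Hsign; specialize (Hsign (mk f i) Hmk'); rewrite Hb in Hsign by exact Hmk;
      (split; [|exact H1]); change (bs (bmp f i)) with (mk f i); rewrite Hb by lra.
    + apply H2. destruct (le_lt_dec (nb f / 2) i) as [|Hs]; [assumption|].
      pose proof (mfun_below f Hf i (mk f i) Hs Hmk); lra.
    + apply H3. destruct (le_lt_dec (nb f / 2) i) as [Hs|]; [|assumption].
      pose proof (mfun_above f Hf i (mk f i) ltac:(lia) Hmk); lra.
Qed.

Definition feet_disjoint (f g : marked) : Prop :=
  forall i j x, (i < nb f)%nat -> (j < nb g)%nat ->
    lfoot f i x \/ rfoot f i x -> lfoot g j x \/ rfoot g j x -> False.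

Lemma fast_feet_disjoint f g : standard f -> standard g -> f <> g -> fast [f; g] ->
  feet_disjoint f g.
Proof.
  intros Hf Hg Hne [Hdiff Hfast] i j x Hi Hj Hx Hx'.
  assert (If : In f [f; g]) by (left; reflexivity).
  assert (Ig : In g [f; g]) by (right; left; reflexivity).
  apply (Hfast f g (bmp f i) (bmp g j) If Ig (bmp_In f i Hi) (bmp_In g j Hj)) with x.
  - intro E; injection E as E _.
    exact (Hdiff f g _ _ If Ig Hne (bmp_In f i Hi) (bmp_In g j Hj) E).
  - split; apply feet_rfoot; assumption.
Qed.

(** A right foot contains [t_a], the image or preimage of the marker according to sign, and
    everything from there to the right end of the bump. *)
Lemma rfoot_near_end f i y : standard f -> (i < nb f)%nat -> y < pt f (S i) ->
  exists z, y < z < pt f (S i) /\ forall x, z <= x < pt f (S i) -> rfoot f i x.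
Proof.
  intros Hf Hi Hy. pose proof (pt_mk f Hf i Hi) as Hmk.
  assert (exists t, rfoot f i t) as [t Ht].
  { destruct (le_lt_dec (nb f / 2) i) as [Hs|Hs].
    - exists (mfun f (mk f i)). split; [|split; [lra|lia]].
      apply (mfun_interval f Hf i (mk f i) Hi), Hmk.
    - destruct (homeo_surj (mfun f) (mk f i) (proj1 (proj1 Hf))) as [t Ht].
      exists t; split; [|split; [lia|lra]].
      apply (mfun_interval f Hf i t Hi); rewrite Ht; exact Hmk. }
  pose proof (rfoot_inside f i t Hf Hi Ht) as Hin.
  pose proof (Rmax_l t y) as M1; pose proof (Rmax_r t y) as M2.
  assert (M3 : Rmax t y < pt f (S i)) by (apply Rmax_lub_lt; lra).
  exists ((Rmax t y + pt f (S i)) / 2); split; [lra|].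
  intros x Hx. destruct Ht as [_ [H2 H3]]. split; [lra|split; intros Hs].
  - specialize (H2 Hs); lra.
  - specialize (H3 Hs). pose proof (mfun_le f t x Hf ltac:(lra)); lra.
Qed.

(** * Bumps numbered from the outside in *)

(* Bumps are numbered in the order in which [circ] peels them: 1 is the rightmost, 2 the
   leftmost, 3 the second from the right, and so on; 0 stands for "no bump".  Odd bumps are
   positive and even ones negative, so every standard function pushes points of a bump
   towards its outer end.  [idx m n] is the position of bump [n] among [m] bumps. *)
Definition idx (m n : nat) : nat :=
  if (n mod 2 =? 1)%nat then (m - (n + 1) / 2)%nat else (n / 2 - 1)%nat.
Definition bnum (m i : nat) : nat :=
  if (m / 2 <=? i)%nat then (2 * (m - i) - 1)%nat else (2 * (i + 1))%nat.

(* The outer end of bump [n] is [endp n] and its inner end is [endp (n + 2)]; beyond the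
   number of bumps, [endp] is the common center, where positive and negative bumps meet. *)
Definition eix (m q : nat) : nat :=
  if (q mod 2 =? 1)%nat then Nat.max (m - q / 2) (m / 2)
  else Nat.min (q / 2 - 1) (m / 2).
Definition endp (f : marked) (q : nat) : R := pt f (eix (nb f) q).

Definition inb (f : marked) (n : nat) (t : R) : Prop :=
  match n with
  | O => forall i, (i < nb f)%nat -> ~ (pt f i < t < pt f (S i))
  | S _ => (n <= nb f)%nat /\ pt f (idx (nb f) n) < t < pt f (S (idx (nb f) n))
  end.

(** Once the boolean tests are split, only halves and remainders are left, which
    [Zify.zify_post_hook] turns into Euclidean equations for [lia]. *)
Ltac ixlia :=
  unfold idx, bnum, eix in *;
  repeat match goal with
  | |- context [Nat.eqb ?a ?b] => destruct (Nat.eqb_spec a b)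
  | |- context [Nat.leb ?a ?b] => destruct (Nat.leb_spec a b)
  | H : context [Nat.eqb ?a ?b] |- _ => destruct (Nat.eqb_spec a b)
  | H : context [Nat.leb ?a ?b] |- _ => destruct (Nat.leb_spec a b)
  end; lia.

Lemma idx_lt m n : (1 <= n <= m -> idx m n < m)%nat.
Proof. ixlia. Qed.
Lemma bnum_idx m n : (1 <= n <= m -> bnum m (idx m n) = n)%nat.
Proof. ixlia. Qed.
Lemma idx_bnum m i : (i < m -> idx m (bnum m i) = i)%nat.
Proof. ixlia. Qed.
Lemma bnum_bounds m i : (i < m -> 1 <= bnum m i <= m)%nat.
Proof. ixlia. Qed.
Lemma eix_le m q : (eix m q <= m)%nat.
Proof. ixlia. Qed.

(** The first alternative is a positive bump, with its outer end on the right; the second is a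
    negative one. *)
Lemma bump_ends m n : (1 <= n <= m)%nat ->
  (eix m n = S (idx m n) /\ eix m (n + 2) = idx m n /\ m / 2 <= idx m n)%nat \/
  (eix m n = idx m n /\ eix m (n + 2) = S (idx m n) /\ idx m n < m / 2)%nat.
Proof. ixlia. Qed.

Lemma interval_index_unique f i j t : standard f -> (i < nb f)%nat -> (j < nb f)%nat ->
  pt f i < t < pt f (S i) -> pt f j < t < pt f (S j) -> i = j.
Proof.
  intros Hf Hi Hj H1 H2. destruct (Nat.lt_total i j) as [H|[H|H]]; [|exact H|].
  - pose proof (pt_le f Hf (S i) j ltac:(lia)); lra.
  - pose proof (pt_le f Hf (S j) i ltac:(lia)); lra.
Qed.

Lemma inb_bnum f i t : (i < nb f)%nat -> pt f i < t < pt f (S i) ->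
  inb f (bnum (nb f) i) t.
Proof.
  intros Hi Ht. pose proof (bnum_bounds _ _ Hi) as Hb. unfold inb.
  destruct (bnum (nb f) i) eqn:E; [lia|].
  rewrite <- E, idx_bnum by exact Hi. split; [lia|exact Ht].
Qed.

Lemma inb_bump f n t : (1 <= n)%nat -> inb f n t <->
  (n <= nb f)%nat /\ pt f (idx (nb f) n) < t < pt f (S (idx (nb f) n)).
Proof. intros Hn; destruct n; [lia|reflexivity]. Qed.

Lemma inb_exists f t : exists n, inb f n t.
Proof.
  destruct (classic (exists i, (i < nb f)%nat /\ pt f i < t < pt f (S i))) as [[i [Hi Ht]]|H].
  - exists (bnum (nb f) i); apply inb_bnum; assumption.
  - exists 0%nat; intros i Hi Ht; apply H; exists i; split; assumption.
Qed.

Lemma inb_unique f n n' t : standard f -> inb f n t -> inb f n' t -> n = n'.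
Proof.
  intros Hf. destruct n as [|n], n' as [|n'].
  - reflexivity.
  - intros H [H1 H2]; exfalso; apply (H (idx (nb f) (S n'))); [apply idx_lt; lia|exact H2].
  - intros [H1 H2] H; exfalso; apply (H (idx (nb f) (S n))); [apply idx_lt; lia|exact H2].
  - intros [H1 H2] [H1' H2'].
    rewrite <- (bnum_idx (nb f) (S n)), <- (bnum_idx (nb f) (S n')) by lia.
    f_equal. apply (interval_index_unique f _ _ t Hf); try assumption; apply idx_lt; lia.
Qed.

Lemma endp_in_ext f q : standard f -> pt f 0 <= endp f q <= pt f (nb f).
Proof.
  intros Hf; pose proof (eix_le (nb f) q).
  split; apply pt_le; trivial; lia.
Qed.

Lemma inb_outside f t : standard f -> t <= pt f 0 \/ pt f (nb f) <= t -> inb f 0 t.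
Proof.
  intros Hf H i Hi Ht.
  pose proof (pt_le f Hf 0 i ltac:(lia)). pose proof (pt_le f Hf (S i) (nb f) ltac:(lia)). lra.
Qed.

(* For [f < g] of oscillation [k] the outer ends are nested, on the right
   [... < endp g 3 < endp f 1 < endp g 1] and on the left [endp g 2 < endp f 2 < endp g 4 < ...],
   until after [k] steps a core of one function lies to the left of a core of the other. *)
Definition linked (f g : marked) (k : nat) : Prop :=
  forall q, (1 <= q)%nat ->
    inb g (Nat.min q k) (endp f q) /\ inb f (Nat.min (q - 2) (k - 1)) (endp g q).

Lemma linked_ll f g : standard f -> standard g -> ll f g -> linked f g 0.
Proof.
  intros Hf Hg H. pose proof (standard_ll f g Hf Hg H) as Hle. intros q Hq.
  replace (Nat.min q 0) with 0%nat by lia. replace (Nat.min (q - 2) (0 - 1)) with 0%nat by lia.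
  pose proof (endp_in_ext f q Hf). pose proof (endp_in_ext g q Hg).
  split; apply inb_outside; trivial; lra.
Qed.

Lemma nth_inner_bumps (l : list bdatum) d i : (i + 2 < length l)%nat ->
  nth i (middle l) d = nth (S i) l d.
Proof.
  intros H. unfold middle. destruct l as [|a l]; simpl in *; [lia|].
  rewrite removelast_firstn_len, nth_firstn.
  destruct (Nat.ltb_spec i (pred (length l))); [reflexivity|lia].
Qed.

Lemma length_middle (l : list bdatum) : length (middle l) = (length l - 2)%nat.
Proof.
  unfold middle. destruct l as [|a l]; simpl; [reflexivity|].
  rewrite removelast_firstn_len, length_firstn; lia.
Qed.

(** * Standard pairs *)

Lemma sqsub_irrefl f : standard f -> ~ sqsub f f.
Proof. intros Hf H; pose proof (standard_sqsub f f Hf Hf H); lra. Qed.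

Lemma inb1 f t : standard f -> endp f 3 < t < endp f 1 -> inb f 1 t.
Proof.
  intros Hf Ht. pose proof (nb_pos f Hf) as Hpos. apply inb_bump; [lia|].
  unfold endp in Ht. split; [lia|].
  replace (S (idx (nb f) 1)) with (eix (nb f) 1) by ixlia.
  replace (idx (nb f) 1) with (eix (nb f) 3) by ixlia. exact Ht.
Qed.

Lemma inb2 f t : (2 <= nb f)%nat -> endp f 2 < t < endp f 4 -> inb f 2 t.
Proof.
  intros Hm Ht. apply inb_bump; [lia|].
  unfold endp in Ht. split; [lia|].
  replace (S (idx (nb f) 2)) with (eix (nb f) 4) by ixlia.
  replace (idx (nb f) 2) with (eix (nb f) 2) by ixlia. exact Ht.
Qed.

Lemma inb1_inv f t : standard f -> inb f 1 t -> endp f 3 < t < endp f 1.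
Proof.
  intros Hf [_ Ht]. pose proof (nb_pos f Hf) as Hpos. unfold endp.
  replace (eix (nb f) 1) with (S (idx (nb f) 1)) by ixlia.
  replace (eix (nb f) 3) with (idx (nb f) 1) by ixlia. exact Ht.
Qed.

Lemma endp_1 f : standard f -> endp f 1 = pt f (nb f).
Proof.
  intros Hf. pose proof (nb_pos f Hf) as Hpos. unfold endp. f_equal. ixlia.
Qed.

Lemma endp_2 f : endp f 2 = pt f 0.
Proof. reflexivity. Qed.

Lemma endp_le_3 f q : standard f -> (2 <= q)%nat -> endp f q <= endp f 3.
Proof.
  intros Hf Hq. pose proof (nb_pos f Hf) as Hpos.
  apply pt_le; trivial; ixlia.
Qed.

Lemma endp_gt_2 f q : standard f -> endp f 2 <= endp f q.
Proof. intros Hf. rewrite endp_2. apply (endp_in_ext f q Hf). Qed.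

Lemma lfoot_start f i y : standard f -> (i < nb f)%nat -> pt f i < y ->
  exists x, pt f i < x < y /\ lfoot f i x.
Proof.
  intros Hf Hi Hy. pose proof (pt_mk f Hf i Hi).
  exists ((pt f i + Rmin y (mk f i)) / 2). unfold lfoot.
  pose proof (Rmin_l y (mk f i)). pose proof (Rmin_r y (mk f i)).
  assert (pt f i < Rmin y (mk f i)) by (apply Rmin_glb_lt; lra). lra.
Qed.

(** Bump [j] of [g] begins with a left foot just right of [pt g j], which would meet the left foot
    of bump [i] of [f]. Equal left ends are excluded as well. *)
Lemma left_end_not_in_lfoot f g i j : standard f -> standard g -> feet_disjoint f g ->
  (i < nb f)%nat -> (j < nb g)%nat -> ~ (pt f i <= pt g j < mk f i).
Proof.
  intros Hf Hg Hd Hi Hj H.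
  destruct (lfoot_start g j (mk f i) Hg Hj) as [x [Hx Hx']]; [lra|].
  apply (Hd i j x Hi Hj); left; [unfold lfoot; lra|exact Hx'].
Qed.

(** * Peeling the outer bumps *)

Section Peel_wide.
Variables g h : marked.
Hypothesis Hg : standard g.
Hypothesis Hm : (2 < nb g)%nat.
Hypothesis Hh : mbumps h = middle (mbumps g).

Lemma nb_middle : nb h = (nb g - 2)%nat.
Proof. unfold nb; rewrite Hh, length_middle; reflexivity. Qed.

Lemma bmp_middle i : (i < nb h)%nat -> bmp h i = bmp g (S i).
Proof.
  pose proof nb_middle. intros Hi. unfold bmp; rewrite Hh.
  apply nth_inner_bumps; fold (nb g); lia.
Qed.

Lemma pt_middle i : (i <= nb h)%nat -> pt h i = pt g (S i).
Proof.
  pose proof nb_middle. intros Hi. destruct i as [|i]; unfold pt.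
  - rewrite bmp_middle by lia. symmetry; apply bmp_contiguous; [exact Hg|lia].
  - rewrite bmp_middle by lia. reflexivity.
Qed.

(** Peeling removes bumps 1 and 2, so the other numbers drop by two, while the center stays. *)
Lemma endp_middle q : (1 <= q)%nat -> endp h q = endp g (q + 2).
Proof.
  pose proof nb_middle as E. intros Hq. unfold endp.
  rewrite pt_middle by apply eix_le. f_equal. rewrite E. ixlia.
Qed.

Lemma inb_middle n t : (1 <= n)%nat -> inb h n t -> inb g (n + 2) t.
Proof.
  pose proof nb_middle as E. intros Hn Ht.
  apply inb_bump in Ht; [|exact Hn]. destruct Ht as [H1 H2].
  pose proof (idx_lt (nb h) n ltac:(lia)).
  apply inb_bump; [lia|]. split; [lia|].
  rewrite !pt_middle in H2 by lia.
  replace (idx (nb g) (n + 2)) with (S (idx (nb h) n)); [exact H2|].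
  rewrite E in *. ixlia.
Qed.
End Peel_wide.

Section Step.
Variables f g h : marked.
Hypothesis Hf : standard f.
Hypothesis Hg : standard g.
Hypothesis Hh : standard h.
Hypothesis Hd : feet_disjoint f g.
Hypothesis Hsq : sqsub f g.
Variable k : nat.
Hypothesis Hlink : linked h f k.
Hypothesis Hrel : (ll h f /\ k = 0%nat) \/ (sqsub h f /\ (1 <= k)%nat).

Lemma outside_ext_of_larger q : (q = 1 \/ q = 2)%nat -> inb f 0 (endp g q).
Proof.
  destruct (standard_sqsub f g Hf Hg Hsq).
  intros [-> | ->]; apply inb_outside; trivial; [rewrite endp_1 by trivial|rewrite endp_2]; lra.
Qed.

(** Ends of [g] from number 3 on are ends of [h], so their half is inherited from [linked h f k]. An
    end of [f] in bump [n >= 1] of [h] is in bump [n + 2] of [g]; the others are located in the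
    peeled bumps 1 and 2. *)
Lemma linked_step_wide : (2 < nb g)%nat -> mbumps h = middle (mbumps g) ->
  linked f g (S k).
Proof.
  intros Hm E. destruct (standard_sqsub f g Hf Hg Hsq) as [S1 S2].
  intros q Hq. split.
  2: { destruct (le_lt_dec q 2).
       - replace (Nat.min (q - 2) (S k - 1)) with 0%nat by lia.
         apply outside_ext_of_larger; lia.
       - replace (endp g q) with (endp h (q - 2)).
         + replace (Nat.min (q - 2) (S k - 1)) with (Nat.min (q - 2) k) by lia.
           apply Hlink; lia.
         + rewrite (endp_middle g h Hg Hm E) by lia. f_equal; lia. }
  pose proof (endp_gt_2 f q Hf) as L2. rewrite endp_2 in L2.
  pose proof (endp_in_ext f q Hf) as [_ R1].
  assert (E1 : endp h 1 = endp g 3) by (apply (endp_middle g h Hg Hm E); lia).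
  assert (E2 : endp h 2 = endp g 4) by (apply (endp_middle g h Hg Hm E); lia).
  destruct (Nat.eq_dec q 1) as [->|Hq1].
  { replace (Nat.min 1 (S k)) with 1%nat by lia.
    apply inb1; trivial. rewrite <- E1, !endp_1 by trivial. split; [|lra].
    destruct Hrel as [[H _]|[H _]].
    - apply standard_ll in H; trivial.
      pose proof (pt_lt f Hf 0 (nb f) ltac:(pose proof (nb_pos f Hf); lia)); lra.
    - apply standard_sqsub in H; trivial; lra. }
  destruct Hrel as [[H Hk]|[H Hk]].
  - replace (Nat.min q (S k)) with 1%nat by lia.
    apply inb1; trivial. rewrite <- E1, !endp_1 by trivial. split; [|lra].
    apply standard_ll in H; trivial.
    (* If [f] started exactly at the inner end of bump 1 of [g], two left feet would overlap
       there. *)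
    destruct (Rle_lt_or_eq_dec _ _ H) as [|Eq]; [lra|exfalso].
    rewrite <- endp_1, E1 in Eq by trivial.
    pose proof (nb_pos f Hf).
    apply (left_end_not_in_lfoot g f (eix (nb g) 3) 0 Hg Hf).
    + intros i j x Hi Hj A B; exact (Hd j i x Hj Hi B A).
    + ixlia.
    + lia.
    + unfold endp in Eq. pose proof (pt_mk g Hg (eix (nb g) 3) ltac:(ixlia)). lra.
  - apply standard_sqsub in H; trivial.
    assert (Hlow : Nat.min (q - 2) (k - 1) = 0%nat -> inb g (Nat.min q (S k)) (endp f q)).
    { intros H0. replace (Nat.min q (S k)) with 2%nat by lia.
      apply inb2; [lia|]. rewrite <- E2, !endp_2. split; [lra|].
      destruct (Nat.eq_dec q 2) as [->|]; [rewrite endp_2; lra|].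
      (* For [k = 1] the left end of [h] lies in bump 1 of [f], so every end of [f] but the first
         lies to its left, in bump 2 of [g]. *)
      assert (k = 1)%nat by lia; subst k.
      pose proof (proj1 (Hlink 2%nat ltac:(lia))) as H2; simpl Nat.min in H2.
      apply inb1_inv in H2; [|exact Hf]. rewrite endp_2 in H2.
      pose proof (endp_le_3 f q Hf ltac:(lia)). lra. }
    destruct (Nat.eq_dec (Nat.min (q - 2) (k - 1)) 0) as [|Hne]; [apply Hlow; assumption|].
    pose proof (proj2 (Hlink q Hq)) as Hin.
    apply (inb_middle g h Hg Hm E) in Hin; [|lia].
    replace (Nat.min q (S k)) with (Nat.min (q - 2) (k - 1) + 2)%nat by lia. exact Hin.
Qed.

(* When [g] has no bump to peel off but its core, [h] is carried by the left foot of the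
   innermost positive bump of [g]; no end of [f] lies there, so [k <= 1]. *)
Lemma linked_step_narrow : (nb g <= 2)%nat -> nb h = 1%nat ->
  pt h 0 = pt g (nb g - 1) -> pt h 1 = mk g (nb g - 1) -> linked f g (S k).
Proof.
  intros Hm Hn P0 P1. destruct (standard_sqsub f g Hf Hg Hsq) as [S1 S2].
  pose proof (nb_pos g Hg) as Hgp. pose proof (nb_pos f Hf) as Hfp.
  pose proof (pt_mk g Hg (nb g - 1) ltac:(lia)) as Hmk.
  assert (Ec : forall q, (3 <= q)%nat -> endp g q = pt g (nb g - 1)).
  { intros q Hq. unfold endp. f_equal. ixlia. }
  assert (H1 : endp h 1 = mk g (nb g - 1)) by (rewrite endp_1, Hn by trivial; exact P1).
  assert (H2 : endp h 2 = pt g (nb g - 1)) by (rewrite endp_2; exact P0).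
  (* For [k >= 2] the ends of [h] lie in bumps 1 and 2 of [f], so the left end of bump 1 of [f]
     falls in the left foot of [g] or on its start. *)
  assert (Hk : (k <= 1)%nat).
  { destruct (le_lt_dec k 1) as [|Hk]; [assumption|exfalso].
    pose proof (proj1 (Hlink 1%nat ltac:(lia))) as I1.
    pose proof (proj1 (Hlink 2%nat ltac:(lia))) as I2.
    replace (Nat.min 1 k) with 1%nat in I1 by lia.
    replace (Nat.min 2 k) with 2%nat in I2 by lia.
    apply inb1_inv in I1; [|exact Hf].
    apply (left_end_not_in_lfoot g f (nb g - 1) (eix (nb f) 3) Hg Hf).
    - intros i j x Hi Hj A B; exact (Hd j i x Hj Hi B A).
    - lia.
    - ixlia.
    - fold (endp f 3). split; [|lra]. apply Rnot_lt_le; intro Hlt.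
      assert (I2' : inb f 1 (endp h 2)) by (apply inb1; trivial; lra).
      pose proof (inb_unique f _ _ _ Hf I2 I2'); lia. }
  intros q Hq. split.
  2: { destruct (le_lt_dec q 2).
       - replace (Nat.min (q - 2) (S k - 1)) with 0%nat by lia.
         apply outside_ext_of_larger; lia.
       - rewrite Ec, <- H2 by lia.
         replace (Nat.min (q - 2) (S k - 1)) with (Nat.min 2 k) by lia.
         apply Hlink; lia. }
  pose proof (endp_gt_2 f q Hf) as L2. rewrite endp_2 in L2.
  pose proof (endp_in_ext f q Hf) as [_ R1].
  destruct (Nat.eq_dec q 1) as [->|Hq1].
  { replace (Nat.min 1 (S k)) with 1%nat by lia.
    apply inb1; trivial. rewrite Ec, !endp_1 by trivial. split; [|lra].
    pose proof (pt_lt f Hf 0 (nb f) ltac:(lia)) as Hfe.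
    destruct Hrel as [[H _]|[H _]].
    - apply standard_ll in H; trivial. rewrite Hn, P1 in H. lra.
    - apply standard_sqsub in H; trivial. rewrite Hn, P0, P1 in H; lra. }
  destruct Hrel as [[H Hk0]|[H Hk1]].
  - replace (Nat.min q (S k)) with 1%nat by lia.
    apply inb1; trivial. rewrite Ec, !endp_1 by trivial.
    apply standard_ll in H; trivial. rewrite Hn, P1 in H. lra.
  - apply standard_sqsub in H; trivial. rewrite Hn, P0, P1 in H.
    assert (k = 1)%nat by lia; subst k.
    replace (Nat.min q 2) with 2%nat by lia.
    pose proof (proj1 (Hlink 2%nat ltac:(lia))) as I2; simpl Nat.min in I2.
    apply inb1_inv in I2; [|exact Hf]. rewrite H2 in I2.
    pose proof (endp_le_3 f q Hf ltac:(lia)).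
    apply inb2.
    (* With a single bump, [g] would start where [h] does, inside the extended support of [f]. *)
    + destruct (Nat.eq_dec (nb g) 1) as [E|]; [exfalso|lia].
      rewrite E in *. simpl in *. lra.
    + rewrite endp_2, Ec by lia. lra.
Qed.
End Step.

(** Each peeling swaps the roles of the two functions and adds one to [k]. The disjunction is
    carried along because a step must know whether [h] lies left of [f] or inside it. *)
Lemma std_pair_linked f g : std_pair f g ->
  exists k, linked f g k /\
    ((ll f g /\ k = 0%nat) \/ (sqsub f g /\ (1 <= k)%nat)).
Proof.
  induction 1 as [f g Hf Hg _ Hll|f g h Hf Hg Hfast Hsq Hcirc Hpair [k [Hlink Hrel]]].
  - exists 0%nat; split; [apply linked_ll; assumption|left; split; [assumption|reflexivity]].
  - exists (S k). split; [|right; split; [assumption|lia]].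
    assert (Hh : standard h) by (inversion Hpair; assumption).
    assert (Hd : feet_disjoint f g).
    { apply fast_feet_disjoint; trivial. intros ->; exact (sqsub_irrefl g Hg Hsq). }
    destruct Hcirc as [_ [[Hm [E _]]|[Hm [b [Hb [Hpos [c [Ec [Eu [Ev _]]]]]]]]]].
    + apply (linked_step_wide f g h); assumption.
    + fold (nb g) in Hm. destruct (In_bmp g b Hb) as [i [Hi ->]].
      (* Of two bumps the left one is negative, so the positive bump is the last. *)
      assert (i = nb g - 1)%nat; [|subst i].
      { destruct (Nat.eq_dec i (nb g - 1)) as [|Hne]; [assumption|exfalso].
        pose proof (proj2 (bmp_sign g Hg i Hi) ltac:(lia)) as Hneg.
        pose proof (bmp_marker g (proj1 Hg) i Hi) as Hmk.
        specialize (Hpos _ Hmk). specialize (Hneg _ Hmk). lra. }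
      apply (linked_step_narrow f g h); trivial.
      * lia.
      * unfold nb; rewrite Ec; reflexivity.
      * unfold pt at 1, bmp; rewrite Ec; simpl nth. rewrite Eu. apply bu_pt; trivial.
      * unfold pt at 1, bmp; rewrite Ec; simpl nth. exact Ev.
Qed.

(** * The oscillation of a linked pair *)

Lemma in_open_b_true u v t : in_open_b u v t = true <-> u < t < v.
Proof.
  unfold in_open_b. destruct (Rlt_dec u t), (Rlt_dec t v); split; intros; try lra; congruence.
Qed.

Lemma transition_points_pt f w : standard f ->
  In w (transition_points f) <-> exists i, (i <= nb f)%nat /\ w = pt f i.
Proof.
  intros Hf. pose proof (nb_pos f Hf) as Hpos. unfold transition_points.
  rewrite in_flat_map. split.
  - intros [b [Hb Hw]]. destruct (In_bmp f b Hb) as [i [Hi ->]].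
    destruct Hw as [<-|[<-|[]]].
    + exists i; split; [lia|apply bu_pt; assumption].
    + exists (S i); split; [lia|reflexivity].
  - intros [[|i] [Hi ->]].
    + exists (bmp f 0); split; [apply bmp_In; lia|left; reflexivity].
    + exists (bmp f i); split; [apply bmp_In; lia|right; left; reflexivity].
Qed.

Lemma eix_surj m i : (i <= m)%nat -> exists q, (1 <= q)%nat /\ eix m q = i.
Proof.
  intros H. destruct (le_lt_dec i (m / 2)).
  - exists (2 * i + 2)%nat; split; [lia|ixlia].
  - exists (2 * (m - i) + 1)%nat; split; [lia|ixlia].
Qed.

Lemma transition_points_endp f w : standard f ->
  In w (transition_points f) <-> exists q, (1 <= q)%nat /\ w = endp f q.
Proof.
  intros Hf. rewrite (transition_points_pt f w Hf). split.
  - intros [i [Hi ->]]. destruct (eix_surj _ _ Hi) as [q [Hq E]].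
    exists q; split; [exact Hq|]. unfold endp; rewrite E; reflexivity.
  - intros [q [Hq ->]]. exists (eix (nb f) q); split; [apply eix_le|reflexivity].
Qed.

Lemma linked_le f g k : linked f g k -> (k <= nb g)%nat.
Proof.
  intros H. destruct k as [|k]; [lia|].
  destruct (H (S k) ltac:(lia)) as [H1 _]. rewrite Nat.min_id in H1. apply H1.
Qed.

Lemma length_same_elements {X : Type} (l l' : list X) : NoDup l -> NoDup l' ->
  (forall x, In x l <-> In x l') -> length l = length l'.
Proof.
  intros H H' E. apply Nat.le_antisymm; apply NoDup_incl_length; trivial; intros x; apply E.
Qed.

(** End [q] of [f] lies in bump [min q k] of [g], so the bumps of [g] that contain ends of [f] are
    those numbered 1 to [k]. *)
Lemma linked_osc f g k : standard f -> standard g -> linked f g k -> osc f g = k.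
Proof.
  intros Hf Hg H. pose proof (linked_le f g k H) as Hk. unfold osc.
  rewrite (length_same_elements _ (map (fun n => bmp g (idx (nb g) n)) (seq 1 k))).
  - rewrite length_map, length_seq; reflexivity.
  - apply NoDup_filter, mbumps_NoDup, Hg.
  - apply NoDup_map_NoDup_ForallPairs; [|apply seq_NoDup].
    intros n n' Hn Hn' E. apply in_seq in Hn, Hn'.
    apply bmp_inj in E; trivial; try (apply idx_lt; lia).
    rewrite <- (bnum_idx (nb g) n), E by lia. apply bnum_idx; lia.
  - intros c. rewrite filter_In, in_map_iff, existsb_exists. split.
    + intros [Hc [w [Hw Hin]]]. destruct (In_bmp g c Hc) as [j [Hj ->]].
      rewrite in_open_b_true, bu_pt in Hin by trivial.
      apply (inb_bnum g j w Hj) in Hin.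
      apply (transition_points_endp f w Hf) in Hw. destruct Hw as [q [Hq ->]].
      pose proof (inb_unique g _ _ _ Hg Hin (proj1 (H q Hq))) as E.
      pose proof (bnum_bounds _ _ Hj).
      exists (bnum (nb g) j); split; [rewrite idx_bnum by exact Hj; reflexivity|].
      apply in_seq; lia.
    + intros [n [<- Hn]]. apply in_seq in Hn.
      pose proof (idx_lt (nb g) n ltac:(lia)) as Hi. split; [apply bmp_In, Hi|].
      exists (endp f n). split.
      * apply (transition_points_endp f _ Hf); exists n; split; [lia|reflexivity].
      * rewrite in_open_b_true, bu_pt by trivial.
        destruct (H n ltac:(lia)) as [H1 _]. replace (Nat.min n k) with n in H1 by lia.
        apply inb_bump in H1; [|lia]. apply H1.
Qed.

Lemma std_pair_standard f g : std_pair f g -> standard f /\ standard g /\ fast [f; g].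
Proof. intros H; inversion H; auto. Qed.

Lemma std_pair_link f g : std_pair f g -> linked f g (osc f g).
Proof.
  intros H. destruct (std_pair_standard f g H) as [Hf [Hg _]].
  destruct (std_pair_linked f g H) as [k [Hk _]].
  rewrite (linked_osc f g k Hf Hg Hk). exact Hk.
Qed.

(** * Dynamics of the feet *)

Definition hinv (h : R -> R) (y : R) : R := epsilon (inhabits 0) (fun x => h x = y).

Definition act (f : marked) (e : bool) : R -> R :=
  if e then mfun f else hinv (mfun f).

(* Destination of [act f e] on bump [n]: the outer foot when [e = true], the inner one
   otherwise; [nb f / 2 <= i] says that the bump is positive. *)
Definition foot (f : marked) (n : nat) (e : bool) (t : R) : Prop :=
  let i := idx (nb f) n in
  (1 <= n <= nb f)%nat /\
  if Bool.eqb e (nb f / 2 <=? i)%nat then rfoot f i t else lfoot f i t.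

Section Dynamics.
Variable f : marked.
Hypothesis Hf : standard f.

Lemma mfun_hinv y : mfun f (hinv (mfun f) y) = y.
Proof.
  unfold hinv. apply (epsilon_spec (inhabits 0) (fun x => mfun f x = y)).
  apply homeo_surj, Hf.
Qed.

Lemma mfun_lt_inv x y : mfun f x < mfun f y -> x < y.
Proof.
  intros H.
  destruct (Rtotal_order x y) as [|[->|H']]; [assumption|lra|].
  apply (mfun_lt f Hf) in H'; lra.
Qed.

Lemma mfun_inj x y : mfun f x = mfun f y -> x = y.
Proof.
  intros E. destruct (Rtotal_order x y) as [H|[|H]]; trivial; apply (mfun_lt f Hf) in H; lra.
Qed.

Lemma hinv_mfun x : hinv (mfun f) (mfun f x) = x.
Proof. apply mfun_inj, mfun_hinv. Qed.

Lemma act_cancel e t : act f (negb e) (act f e t) = t.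
Proof. destruct e; simpl; [apply hinv_mfun|apply mfun_hinv]. Qed.

Lemma act_cancel' e t : act f e (act f (negb e) t) = t.
Proof. destruct e; simpl; [apply mfun_hinv|apply hinv_mfun]. Qed.

Lemma act_lt e x y : x < y -> act f e x < act f e y.
Proof.
  destruct e; simpl; intros H; [apply mfun_lt; assumption|].
  apply mfun_lt_inv. rewrite !mfun_hinv; exact H.
Qed.

Lemma act_interval e i t : (i < nb f)%nat ->
  pt f i < t < pt f (S i) <-> pt f i < act f e t < pt f (S i).
Proof.
  intros Hi. destruct e; simpl; [apply mfun_interval; assumption|].
  rewrite (mfun_interval f Hf i (hinv (mfun f) t) Hi), mfun_hinv; reflexivity.
Qed.

Lemma act_inb e n t : inb f n t -> inb f n (act f e t).
Proof.
  destruct n as [|n]; simpl.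
  - intros H i Hi Ht. apply (H i Hi), (act_interval e i t Hi), Ht.
  - intros [Hn Ht]; split; [exact Hn|].
    apply (act_interval e _ t (idx_lt (nb f) (S n) ltac:(lia))), Ht.
Qed.

Lemma act_fixed e t : inb f 0 t -> act f e t = t.
Proof.
  intros H. assert (E : mfun f t = t).
  { apply NNPP; intro Hne. destruct (supt_pt f Hf t Hne) as [i [Hi Ht]].
    exact (H i Hi Ht). }
  destruct e; simpl; [exact E|]. rewrite <- E at 1. apply hinv_mfun.
Qed.

Lemma act_moved e n t : (1 <= n)%nat -> inb f n t -> act f e t <> t.
Proof.
  intros Hn Ht E. assert (E' : mfun f t = t).
  { destruct e; simpl in E; [exact E|]. rewrite <- E at 1. apply mfun_hinv. }
  apply inb_bump in Ht; [|exact Hn]. destruct Ht as [Hn' Ht].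
  pose proof (idx_lt (nb f) n ltac:(lia)) as Hi.
  destruct (le_lt_dec (nb f / 2) (idx (nb f) n)).
  - pose proof (mfun_above f Hf (idx (nb f) n) t ltac:(lia) Ht); lra.
  - pose proof (mfun_below f Hf (idx (nb f) n) t ltac:(lia) Ht); lra.
Qed.

Lemma foot_inb n e t : foot f n e t -> inb f n t.
Proof.
  intros [Hn H]. apply inb_bump; [lia|]. split; [lia|].
  pose proof (idx_lt (nb f) n ltac:(lia)) as Hi.
  pose proof (pt_mk f Hf _ Hi).
  destruct (Bool.eqb e _).
  - pose proof (rfoot_inside f _ t Hf Hi H); lra.
  - unfold lfoot in H; lra.
Qed.

Lemma foot_feet n e t : foot f n e t ->
  (idx (nb f) n < nb f)%nat /\ (lfoot f (idx (nb f) n) t \/ rfoot f (idx (nb f) n) t).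
Proof.
  intros [Hn H]. split; [apply idx_lt; lia|]. destruct (Bool.eqb e _); auto.
Qed.

Lemma lfoot_foot i t : (i < nb f)%nat -> lfoot f i t ->
  exists e, foot f (bnum (nb f) i) e t.
Proof.
  intros Hi H. exists (negb (nb f / 2 <=? i)%nat). split; [apply bnum_bounds, Hi|].
  rewrite idx_bnum by exact Hi. destruct (nb f / 2 <=? i)%nat; exact H.
Qed.

Lemma foot_excl n e t : foot f n e t -> ~ foot f n (negb e) t.
Proof.
  intros [Hn H] [_ H']. pose proof (idx_lt (nb f) n ltac:(lia)) as Hi.
  assert (Hlr : lfoot f (idx (nb f) n) t -> rfoot f (idx (nb f) n) t -> False).
  { intros L R. pose proof (rfoot_inside f _ t Hf Hi R). unfold lfoot in L; lra. }
  destruct e, (nb f / 2 <=? idx (nb f) n)%nat; cbn in *; auto.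
Qed.

(** Ping-pong: the feet are [(u, s)] and [[t_a, v)], where [t_a] is the image of [s] under the
    letter that moves points right, so whatever is outside the departure foot lands in the
    destination foot. *)
Lemma foot_push n e t : (1 <= n)%nat -> inb f n t -> ~ foot f n (negb e) t ->
  foot f n e (act f e t).
Proof.
  intros Hn Ht Hno. apply inb_bump in Ht; [|exact Hn]. destruct Ht as [Hn' Ht].
  split; [lia|]. set (i := idx (nb f) n) in *.
  assert (Hi : (i < nb f)%nat) by (apply idx_lt; lia).
  assert (Ht' : pt f i < act f e t < pt f (S i)) by (apply (act_interval e i t Hi); exact Ht).
  assert (Hno' : ~ (if Bool.eqb (negb e) (nb f / 2 <=? i)%nat
                    then rfoot f i t else lfoot f i t)).
  { intro H; apply Hno; split; [lia|exact H]. }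
  clear Hno. destruct e; destruct (Nat.leb_spec (nb f / 2) i); cbn [negb Bool.eqb act] in *.
  - split; [lra|]. split; intros Hs; [|lia]. apply mfun_le; trivial.
    apply Rnot_lt_le; intro; apply Hno'; unfold lfoot; lra.
  - split; [lra|]. apply Rnot_le_lt; intro.
    apply Hno'; split; [lra|]. split; intros Hs; [lia|assumption].
  - split; [lra|]. apply mfun_lt_inv. rewrite mfun_hinv. apply Rnot_le_lt; intro.
    apply Hno'; split; [lra|]. split; intros Hs; [assumption|lia].
  - split; [lra|]. rewrite mfun_hinv. split; intros Hs; [lia|].
    apply Rnot_lt_le; intro; apply Hno'; unfold lfoot; lra.
Qed.

(** A step from the departure foot ends short of the destination foot. Hence a letter and its
    inverse are never adjacent in a history. *)
Lemma foot_pop n e t : foot f n (negb e) t -> ~ foot f n e (act f e t).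
Proof.
  intros [Hn H] [_ H']. pose proof (idx_lt (nb f) n ltac:(lia)) as Hi.
  set (i := idx (nb f) n) in *.
  destruct e; destruct (Nat.leb_spec (nb f / 2) i) as [Hs|Hs]; cbn [negb Bool.eqb act] in *.
  - destruct H' as [_ [H' _]]. specialize (H' Hs).
    destruct H as [_ H]. apply (mfun_lt f Hf) in H. lra.
  - destruct H as [_ [_ H]]. specialize (H Hs). destruct H' as [_ H']. lra.
  - destruct H as [_ [H _]]. specialize (H Hs).
    destruct H' as [_ H']. apply (mfun_lt f Hf) in H'. rewrite mfun_hinv in H'. lra.
  - destruct H' as [_ [_ H']]. rewrite mfun_hinv in H'. specialize (H' Hs).
    destruct H as [_ H]. lra.
Qed.

Lemma foot_stays n e t : foot f n e t -> foot f n e (act f e t).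
Proof.
  intros H. apply foot_push.
  - apply H.
  - apply foot_inb with e, H.
  - apply foot_excl, H.
Qed.

Lemma marker_not_in_own_foot n i e : (i < nb f)%nat -> ~ foot f n e (mk f i).
Proof.
  intros Hi H. pose proof (pt_mk f Hf i Hi) as Hmk.
  destruct (foot_feet _ _ _ H) as [Hi' Hfeet].
  pose proof (pt_mk f Hf _ Hi') as Hmk'.
  assert (E : i = idx (nb f) n).
  { apply (interval_index_unique f _ _ (mk f i) Hf Hi Hi' Hmk).
    apply foot_inb in H. apply inb_bump in H; [apply H|].
    destruct n; [|lia]. exfalso; exact (H i Hi Hmk). }
  destruct Hfeet as [L|R]; rewrite <- E in *; [unfold lfoot in L; lra|].
  pose proof (rfoot_inside f i _ Hf Hi R); lra.
Qed.

Lemma marker_push n e : (1 <= n <= nb f)%nat ->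
  foot f n e (act f e (mk f (idx (nb f) n))).
Proof.
  intros Hn. assert (Hi : (idx (nb f) n < nb f)%nat) by (apply idx_lt; lia).
  apply foot_push; [lia| |apply marker_not_in_own_foot, Hi].
  apply inb_bump; [lia|]. split; [lia|]. apply pt_mk; trivial.
Qed.

End Dynamics.

(** * Feet of one function in the bumps of another *)

Lemma rfoot_up f i x y : standard f -> rfoot f i x -> x <= y < pt f (S i) -> rfoot f i y.
Proof.
  intros Hf [_ [H2 H3]] Hy. split; [lra|split; intros Hs].
  - specialize (H2 Hs); lra.
  - specialize (H3 Hs). pose proof (mfun_le f x y Hf ltac:(lra)); lra.
Qed.

Section Pair.
Variables f g : marked.
Hypothesis Hf : standard f.
Hypothesis Hg : standard g.
Hypothesis Hd : feet_disjoint f g.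

(** A bump of [g] containing only one of [y] and [pt f i] would have an end between them, and its
    foot at that end would meet the left foot of [f]. *)
Lemma lfoot_bump i j y : (i < nb f)%nat -> (j < nb g)%nat -> lfoot f i y ->
  pt g j < y < pt g (S j) <-> pt g j < pt f i < pt g (S j).
Proof.
  intros Hi Hj Hy. pose proof Hy as [Y1 Y2]. split; intros [H1 H2].
  - split; [|lra]. apply Rnot_le_lt; intro Hle.
    apply (left_end_not_in_lfoot f g i j Hf Hg Hd Hi Hj). lra.
  - split; [lra|]. apply Rnot_le_lt; intro Hle.
    destruct (rfoot_near_end g j (pt f i) Hg Hj H2) as [z [Hz Hr]].
    apply (Hd i j z Hi Hj); [left; unfold lfoot; lra|right; apply Hr; lra].
Qed.

Lemma rfoot_bump i j y : (i < nb f)%nat -> (j < nb g)%nat -> rfoot f i y ->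
  pt g j < y < pt g (S j) <-> pt g j < pt f (S i) < pt g (S j).
Proof.
  intros Hi Hj Hy. pose proof (rfoot_inside f i y Hf Hi Hy) as Hin. split; intros [H1 H2].
  - split; [lra|]. apply Rnot_le_lt; intro Hle.
    destruct (rfoot_near_end g j y Hg Hj H2) as [z [Hz Hr]].
    apply (Hd i j z Hi Hj); [right|right; apply Hr; lra].
    apply (rfoot_up f i y); trivial; lra.
  - split; [|lra]. apply Rnot_le_lt; intro Hle.
    destruct (lfoot_start g j (pt f (S i)) Hg Hj H1) as [z [Hz Hl]].
    apply (Hd i j z Hi Hj); [right|left; exact Hl].
    apply (rfoot_up f i y); trivial; lra.
Qed.

Definition foot_end (n : nat) (e : bool) : nat := if e then n else (n + 2)%nat.

Lemma foot_bump n e y j : foot f n e y -> (j < nb g)%nat ->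
  pt g j < y < pt g (S j) <-> pt g j < endp f (foot_end n e) < pt g (S j).
Proof.
  intros [Hn H] Hj. pose proof (idx_lt (nb f) n ltac:(lia)) as Hi.
  unfold endp, foot_end.
  destruct (bump_ends (nb f) n Hn) as [[E1 [E2 E3]]|[E1 [E2 E3]]];
    destruct (Nat.leb_spec (nb f / 2) (idx (nb f) n)); try lia;
    destruct e; simpl in H; rewrite ?E1, ?E2;
    first [apply lfoot_bump; assumption | apply rfoot_bump; assumption].
Qed.

Lemma foot_inb_end n e y j : foot f n e y -> inb g j (endp f (foot_end n e)) -> inb g j y.
Proof.
  intros H. destruct j as [|j]; simpl.
  - intros Hno i Hi Hy. apply (Hno i Hi), (foot_bump n e y i H Hi), Hy.
  - intros [Hj Hin]. split; [exact Hj|].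
    apply (foot_bump n e y _ H); [apply idx_lt; lia|exact Hin].
Qed.
End Pair.

(** * Histories *)

Definition letter : Type := marked * bool.

(* Two families of standard functions indexed by the same list [D] are compared, so a family
   is a function [F] on indices; [T f g q] is the number of the bump of [F g] that contains
   [endp (F f) q]. *)
Definition system (D : list marked) (F : marked -> marked) (T : marked -> marked -> nat -> nat)
  : Prop :=
  (forall f, In f D -> standard (F f)) /\
  (forall f g, In f D -> In g D -> f <> g -> feet_disjoint (F f) (F g)) /\
  (forall f g q, In f D -> In g D -> f <> g -> (1 <= q)%nat ->
     inb (F g) (T f g q) (endp (F f) q)).

Fixpoint ev (F : marked -> marked) (w : list letter) (t : R) : R :=
  match w with
  | [] => t
  | (f, e) :: w' => ev F w' (act (F f) e t)
  end.

(* The most recent letter of a stack is its head, so it is applied last. *)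
Fixpoint stack (F : marked -> marked) (z : R) (P : list letter) : R :=
  match P with
  | [] => z
  | (f, e) :: P' => act (F f) e (stack F z P')
  end.

Definition over (D : list marked) (w : list letter) : Prop := forall l, In l w -> In (fst l) D.

Lemma over_cons D l w : over D (l :: w) <-> In (fst l) D /\ over D w.
Proof.
  unfold over; simpl; split.
  - intros H; split; [apply H; left; reflexivity|intros x Hx; apply H; right; exact Hx].
  - intros [H1 H2] x [<-|Hx]; [exact H1|apply H2, Hx].
Qed.

Section System.
Variable D : list marked.
Variable F : marked -> marked.
Variable T : marked -> marked -> nat -> nat.
Hypothesis HS : system D F T.

Lemma sys_std f : In f D -> standard (F f).
Proof. apply HS. Qed.

Lemma foot_table f g n e y : In f D -> In g D -> f <> g -> foot (F f) n e y ->
  inb (F g) (T f g (foot_end n e)) y.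
Proof.
  intros If Ig Hne H. pose proof HS as [HS1 [HS2 HS3]].
  apply (foot_inb_end (F f) (F g) (HS1 f If) (HS1 g Ig) (HS2 f g If Ig Hne) n e y _ H).
  apply HS3; trivial. destruct H as [Hn _]. unfold foot_end; destruct e; lia.
Qed.

Lemma foot_unique f n e f' n' e' t : In f D -> In f' D ->
  foot (F f) n e t -> foot (F f') n' e' t -> f = f' /\ n = n' /\ e = e'.
Proof.
  intros If If' H H'. destruct (classic (f = f')) as [->|Hne].
  - assert (n = n') as <-.
    { apply (inb_unique (F f') n n' t (sys_std f' If')).
      - apply foot_inb in H; trivial. apply sys_std, If'.
      - apply foot_inb in H'; trivial. apply sys_std, If'. }
    repeat split; trivial. destruct (Bool.bool_dec e e') as [|Hne]; [assumption|exfalso].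
    apply (foot_excl (F f') (sys_std f' If') n e t H).
    replace (negb e) with e' by (destruct e, e'; simpl; congruence). exact H'.
  - exfalso. destruct (foot_feet _ _ _ _ H) as [Hi Hx].
    destruct (foot_feet _ _ _ _ H') as [Hi' Hx'].
    exact (proj1 (proj2 HS) f f' If If' Hne _ _ t Hi Hi' Hx Hx').
Qed.

(** [P] lists the letters undone on the way from [t] to a point [y] in no foot, most recent first.
    It is a relation because the undoing may never stop. *)
Inductive hist : R -> list letter -> R -> Prop :=
| hist_nil y : (forall f n e, In f D -> ~ foot (F f) n e y) -> hist y [] y
| hist_cons y f n e P t : In f D -> foot (F f) n e t ->
    hist y P (act (F f) (negb e) t) -> hist y ((f, e) :: P) t.

Lemma hist_unique y P t y' P' : hist y P t -> hist y' P' t -> y = y' /\ P = P'.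
Proof.
  intros H; revert y' P'. induction H as [y Hno|y f n e P t If Hfoot H IH]; intros y' P' H'.
  - inversion H' as [y0 Hno'|y0 f n e P0 t0 If Hfoot H0]; subst.
    + split; reflexivity.
    + exfalso; exact (Hno f n e If Hfoot).
  - inversion H' as [y0 Hno'|y0 f0 n0 e0 P0 t0 If0 Hfoot0 H0]; subst.
    + exfalso; exact (Hno' f n e If Hfoot).
    + destruct (foot_unique f n e f0 n0 e0 t If If0 Hfoot Hfoot0) as [<- [<- <-]].
      destruct (IH _ _ H0) as [-> ->]. split; reflexivity.
Qed.

Lemma hist_stack y P t : hist y P t -> t = stack F y P.
Proof.
  induction 1 as [y Hno|y f n e P t If Hfoot H IH]; simpl; [reflexivity|].
  rewrite <- IH. symmetry; apply act_cancel', sys_std, If.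
Qed.

Lemma hist_over y P t : hist y P t -> over D P.
Proof.
  induction 1 as [y Hno|y f n e P t If Hfoot H IH]; [intros l []|].
  apply over_cons; split; assumption.
Qed.

Lemma hist_push y P f n e t : In f D -> hist y P t ->
  foot (F f) n e (act (F f) e t) -> hist y ((f, e) :: P) (act (F f) e t).
Proof.
  intros If H Hfoot. apply hist_cons with n; trivial.
  rewrite act_cancel by (apply sys_std, If). exact H.
Qed.

(** Outside the bumps of [F f] the letter fixes the point, in its departure foot it pops, and
    elsewhere in a bump it pushes. *)
Lemma hist_step y P t f e : In f D -> hist y P t ->
  exists P', hist y P' (act (F f) e t) /\
    ((act (F f) e t = t /\ P' = P) \/
     (act (F f) e t <> t /\ (P' = (f, e) :: P \/ P = (f, negb e) :: P'))).
Proof.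
  intros If H. pose proof (sys_std f If) as Hf.
  destruct (inb_exists (F f) t) as [[|n] Hn].
  - exists P. pose proof (act_fixed (F f) Hf e t Hn) as E. rewrite E; auto.
  - pose proof (act_moved (F f) Hf e (S n) t ltac:(lia) Hn) as Hmove.
    destruct (classic (foot (F f) (S n) (negb e) t)) as [Hfoot|Hno].
    + inversion H as [y0 Hno'|y0 f0 n0 e0 P0 t0 If0 Hfoot0 H0]; subst.
      * exfalso; exact (Hno' f _ _ If Hfoot).
      * destruct (foot_unique f _ _ f0 n0 e0 t If If0 Hfoot Hfoot0) as [<- [<- <-]].
        exists P0. rewrite Bool.negb_involutive in H0. auto.
    + exists ((f, e) :: P). split; [|auto].
      apply hist_push with (S n); trivial. apply foot_push; trivial; lia.
Qed.

(** * Points with finite history *)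

Definition markers : list R :=
  flat_map (fun f => map (mk (F f)) (seq 0 (nb (F f)))) D.

Lemma in_markers x : In x markers <-> exists f i, In f D /\ (i < nb (F f))%nat /\ x = mk (F f) i.
Proof.
  unfold markers; rewrite in_flat_map. split.
  - intros [f [If H]]. apply in_map_iff in H. destruct H as [i [<- Hi]].
    apply in_seq in Hi. exists f, i; repeat split; trivial; lia.
  - intros [f [i [If [Hi ->]]]]. exists f; split; [exact If|].
    apply in_map, in_seq; lia.
Qed.

(* A marker can only lie in a foot as the closed end of a right foot [[t, v)], in which case
   it is the image of a smaller marker. *)
Lemma marker_pop f i g n e : In f D -> (i < nb (F f))%nat -> In g D ->
  foot (F g) n e (mk (F f) i) ->
  In (act (F g) (negb e) (mk (F f) i)) markers /\
  act (F g) (negb e) (mk (F f) i) < mk (F f) i.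
Proof.
  intros If Hi Ig H. pose proof (sys_std f If) as Hf. pose proof (sys_std g Ig) as Hg.
  assert (Hne : f <> g).
  { intros <-. exact (marker_not_in_own_foot (F f) Hf n i e Hi H). }
  pose proof (proj1 (proj2 HS) f g If Ig Hne) as Hd.
  destruct H as [Hn H].
  assert (Hj : (idx (nb (F g)) n < nb (F g))%nat) by (apply idx_lt; lia).
  set (j := idx (nb (F g)) n) in *. set (x := mk (F f) i) in *.
  pose proof (pt_mk (F f) Hf i Hi) as Hmk. fold x in Hmk.
  assert (Hleft : forall z, z < x -> exists u, z < u < x /\ lfoot (F f) i u).
  { intros z Hz. pose proof (Rmax_l z (pt (F f) i)). pose proof (Rmax_r z (pt (F f) i)).
    assert (Rmax z (pt (F f) i) < x) by (apply Rmax_lub_lt; lra).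
    exists ((Rmax z (pt (F f) i) + x) / 2). unfold lfoot; fold x; lra. }
  assert (Hr : rfoot (F g) j x).
  { destruct (Bool.eqb e _); [exact H|exfalso].
    destruct (Hleft (pt (F g) j)) as [u [Hu Hu']]; [apply H|].
    apply (Hd i j u Hi Hj); left; [exact Hu'|unfold lfoot in *; lra]. }
  (* Points of the left foot at [x] approach [x] from below, so [x] is the least point of the right
     foot, that is, its [t_a]; undoing the letter returns the marker. *)
  assert (Hmin : forall z, z < x -> ~ rfoot (F g) j z).
  { intros z Hz Hrz. destruct (Hleft z Hz) as [u [Hu Hu']].
    apply (Hd i j u Hi Hj); [left; exact Hu'|right].
    apply (rfoot_up (F g) j z); trivial. destruct Hr as [Hr _]; lra. }
  pose proof (rfoot_inside (F g) j x Hg Hj Hr) as Hin.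
  pose proof (pt_mk (F g) Hg j Hj) as Hmkj.
  assert (E : act (F g) (negb e) x = mk (F g) j).
  { destruct Hr as [Hr1 [Hr2 Hr3]].
    destruct e; destruct (Nat.leb_spec (nb (F g) / 2) j) as [Hs|Hs];
      cbn [Bool.eqb negb act] in *; try (unfold lfoot in H; lra).
    - apply (mfun_inj (F g) Hg). rewrite mfun_hinv by exact Hg.
      apply Rle_antisym; [|apply Hr2, Hs].
      apply Rnot_lt_le; intro Hlt. apply (Hmin _ Hlt).
      split; [lra|split; [lra|lia]].
    - apply Rle_antisym; [|apply Hr3, Hs].
      apply Rnot_lt_le; intro Hlt. apply (Hmin (hinv (mfun (F g)) (mk (F g) j))).
      + apply (mfun_lt_inv (F g) Hg). rewrite mfun_hinv by exact Hg. exact Hlt.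
      + rewrite <- (mfun_hinv (F g) Hg (mk (F g) j)) in Hlt.
        apply (mfun_lt_inv (F g) Hg) in Hlt.
        split; [lra|split; [lia|]]. rewrite mfun_hinv by exact Hg. lra. }
  rewrite E. split; [|lra]. apply in_markers. exists g, j; auto.
Qed.

(** Undoing a letter at a marker gives a smaller marker, and there are finitely many; induction on
    the number of smaller ones. *)
Lemma hist_marker x : In x markers -> exists y P, hist y P x.
Proof.
  remember (length (filter (fun y => if Rlt_dec y x then true else false) markers)) as N eqn:EN.
  revert x EN. induction N as [N IH] using (well_founded_induction lt_wf).
  intros x EN Hx.
  destruct (classic (exists f n e, In f D /\ foot (F f) n e x)) as [[g [n [e [Ig H]]]]|Hno].
  - pose proof Hx as Hx'. apply in_markers in Hx'. destruct Hx' as [f [i [If [Hi Ex]]]].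
    rewrite Ex in H. destruct (marker_pop f i g n e If Hi Ig H) as [Hin Hlt].
    rewrite <- Ex in H, Hin, Hlt. set (x' := act (F g) (negb e) x) in *.
    destruct (IH (length (filter (fun y => if Rlt_dec y x' then true else false) markers)))
      with (x := x') as [y [P HP]]; trivial.
    (* The count drops because [x'] is counted below [x] but not below itself. *)
    + rewrite EN. clear - Hin Hlt. induction markers as [|m l IHl]; [destruct Hin|].
      assert (Hle : forall l, (length (filter (fun y => if Rlt_dec y x' then true else false) l)
                 <= length (filter (fun y => if Rlt_dec y x then true else false) l))%nat).
      { clear l IHl Hin. induction l as [|m' l IHl]; simpl; [lia|].
        destruct (Rlt_dec m' x'), (Rlt_dec m' x); simpl; try lia. lra. }
      simpl. destruct Hin as [->|Hin].
      * destruct (Rlt_dec x' x'), (Rlt_dec x' x); simpl; try lra.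
        specialize (Hle l); lia.
      * specialize (IHl Hin). destruct (Rlt_dec m x'), (Rlt_dec m x); simpl; try lia. lra.
    + exists y, ((g, e) :: P). apply hist_cons with n; assumption.
  - exists x, []. apply hist_nil. intros f n e If H; apply Hno; exists f, n, e; auto.
Qed.

Lemma hist_push_marker f n e : In f D -> (1 <= n <= nb (F f))%nat ->
  exists y P t, hist y P t /\ foot (F f) n e t.
Proof.
  intros If Hn. pose proof (sys_std f If) as Hf.
  assert (Hi : (idx (nb (F f)) n < nb (F f))%nat) by (apply idx_lt; lia).
  destruct (hist_marker (mk (F f) (idx (nb (F f)) n))) as [y [P HP]].
  { apply in_markers. exists f, (idx (nb (F f)) n); auto. }
  pose proof (marker_push (F f) Hf n e Hn) as Hfoot.
  eexists y, ((f, e) :: P), _. split; [|exact Hfoot].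
  apply hist_push with n; trivial.
Qed.

(** Each further application of the letter leads one step deeper into the same foot. *)
Lemma hist_deep_in_foot f n e k : In f D -> (1 <= n <= nb (F f))%nat ->
  exists y P t, hist y P t /\
    forall j, (j <= k)%nat -> foot (F f) n e (Nat.iter j (act (F f) (negb e)) t).
Proof.
  intros If Hn. pose proof (sys_std f If) as Hf. induction k as [|k IH].
  - destruct (hist_push_marker f n e If Hn) as [y [P [t [H Ht]]]].
    exists y, P, t; split; [exact H|]. intros j Hj. replace j with 0%nat by lia. exact Ht.
  - destruct IH as [y [P [t [H Ht]]]].
    pose proof (foot_stays (F f) Hf n e t (Ht 0%nat ltac:(lia))) as Hst.
    exists y, ((f, e) :: P), (act (F f) e t). split; [apply hist_push with n; trivial|].
    intros [|j] Hj; [exact Hst|].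
    rewrite Nat.iter_succ_r, act_cancel by exact Hf. apply Ht; lia.
Qed.

(** * Orbits of words and long histories *)

Lemma ev_lt w x y : over D w -> x < y -> ev F w x < ev F w y.
Proof.
  revert x y. induction w as [|[f e] w IH]; intros x y Hw H; simpl; [exact H|].
  apply over_cons in Hw. destruct Hw as [If Hw]. apply IH; [exact Hw|].
  apply act_lt; [apply sys_std, If|exact H].
Qed.

Lemma hist_ev w y P t : over D w -> hist y P t -> exists P', hist y P' (ev F w t).
Proof.
  revert P t. induction w as [|[f e] w IH]; intros P t Hw H; simpl; [exists P; exact H|].
  apply over_cons in Hw. destruct Hw as [If Hw].
  destruct (hist_step y P t f e If H) as [P' [H' _]]. exact (IH P' _ Hw H').
Qed.

(** At least [d] letters can be undone; this includes points whose history is infinite. *)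
Fixpoint deep (d : nat) (t : R) : Prop :=
  match d with
  | O => True
  | S d' => exists f n e, In f D /\ foot (F f) n e t /\ deep d' (act (F f) (negb e) t)
  end.

Lemma not_deep d t : ~ deep d t -> exists y P, hist y P t /\ (length P < d)%nat.
Proof.
  revert t. induction d as [|d IH]; simpl; intros t H; [exfalso; apply H; exact I|].
  destruct (classic (exists f n e, In f D /\ foot (F f) n e t)) as [[f [n [e [If Hfoot]]]]|Hno].
  - destruct (IH (act (F f) (negb e) t)) as [y [P [HP HL]]].
    + intro Hd; apply H; exists f, n, e; auto.
    + exists y, ((f, e) :: P); split; [apply hist_cons with n; assumption|simpl; lia].
  - exists t, []; split; [|simpl; lia]. apply hist_nil.
    intros f n e If Hfoot; apply Hno; exists f, n, e; auto.
Qed.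

Fixpoint short_words (d : nat) : list (list letter) :=
  match d with
  | O => []
  | S d' => [] :: flat_map (fun P => flat_map (fun f => [(f, true) :: P; (f, false) :: P]) D)
                    (short_words d')
  end.

Lemma in_short_words d P : over D P -> (length P < d)%nat -> In P (short_words d).
Proof.
  revert d. induction P as [|[f e] P IH]; intros [|d] HP HL; simpl in *; try lia.
  - left; reflexivity.
  - right. apply over_cons in HP. destruct HP as [If HP].
    apply in_flat_map. exists P; split; [apply IH; [exact HP|lia]|].
    apply in_flat_map. exists f; split; [exact If|].
    destruct e; simpl; auto.
Qed.

Lemma iter_lt (u : R -> R) t : (forall x y, x < y -> u x < u y) -> t < u t ->
  forall i j, (i < j)%nat -> Nat.iter i u t < Nat.iter j u t.
Proof.
  intros Hu Ht i j Hij.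
  assert (Hs : forall i, Nat.iter i u t < Nat.iter (S i) u t).
  { intros k; induction k as [|k IH]; [exact Ht|simpl; apply Hu, IH]. }
  induction Hij as [|j Hij IH]; [apply Hs|]. specialize (Hs j); lra.
Qed.

Lemma iter_gt (u : R -> R) t : (forall x y, x < y -> u x < u y) -> u t < t ->
  forall i j, (i < j)%nat -> Nat.iter j u t < Nat.iter i u t.
Proof.
  intros Hu Ht i j Hij.
  assert (Hs : forall i, Nat.iter (S i) u t < Nat.iter i u t).
  { intros k; induction k as [|k IH]; [exact Ht|simpl; apply Hu, IH]. }
  induction Hij as [|j Hij IH]; [apply Hs|]. specialize (Hs j); lra.
Qed.

Lemma iter_moved (u : R -> R) t i j : (forall x y, x < y -> u x < u y) -> u t <> t ->
  Nat.iter i u t = Nat.iter j u t -> i = j.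
Proof.
  intros Hu Ht E. destruct (Nat.lt_total i j) as [H|[H|H]]; [|exact H|]; exfalso;
    (destruct (Rtotal_order t (u t)) as [H'|[H'|H']];
     [pose proof (iter_lt u t Hu H' _ _ H)|congruence|pose proof (iter_gt u t Hu H' _ _ H)]; lra).
Qed.

(* An infinite orbit cannot consist of points with short histories: all points of an orbit
   share the base of their histories, and there are finitely many short words. *)
Lemma moved_deep w t d : over D w -> ev F w t <> t ->
  exists t', ev F w t' <> t' /\ deep d t'.
Proof.
  intros Hw Ht. apply NNPP; intro Hno.
  assert (Hinc : forall x y, x < y -> ev F w x < ev F w y)
    by (intros; apply ev_lt; assumption).
  (* [ev F w] is increasing, so all iterates of [t] are distinct and moved, and the assumption makes
     their histories short. *)
  assert (Hsh : forall N, exists y P, hist y P (Nat.iter N (ev F w) t) /\ (length P < d)%nat).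
  { intros N. apply not_deep. intro Hd. apply Hno.
    exists (Nat.iter N (ev F w) t); split; [|exact Hd].
    intro E. apply (iter_moved (ev F w) t (S N) N Hinc) in E; [lia|exact Ht]. }
  destruct (Hsh 0%nat) as [y [P0 [H0 _]]]. simpl in H0.
  assert (Hb : forall N, exists P, hist y P (Nat.iter N (ev F w) t)).
  { induction N as [|N [P IH]]; [exists P0; exact H0|]. apply (hist_ev w y P); assumption. }
  set (l := map (stack F y) (short_words d)).
  assert (Hin : forall N, In (Nat.iter N (ev F w) t) l).
  { intros N. destruct (Hsh N) as [y' [P [HP HL]]]. destruct (Hb N) as [P' HP'].
    destruct (hist_unique _ _ _ _ _ HP' HP) as [<- <-].
    rewrite (hist_stack _ _ _ HP). apply in_map, in_short_words; [|exact HL].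
    apply (hist_over _ _ _ HP). }
  assert (Hle : (length (map (fun N => Nat.iter N (ev F w) t) (seq 0 (S (length l))))
                 <= length l)%nat).
  { apply NoDup_incl_length.
    - apply NoDup_map_NoDup_ForallPairs; [|apply seq_NoDup].
      intros i j _ _ E. exact (iter_moved _ _ _ _ Hinc Ht E).
    - intros x Hx. apply in_map_iff in Hx. destruct Hx as [N [<- _]]. apply Hin. }
  rewrite length_map, length_seq in Hle. lia.
Qed.

(** Letters act bijectively. The base [z] is unrestricted and may lie in a foot. *)
Lemma stack_solve P t : over D P -> exists z, t = stack F z P.
Proof.
  revert t. induction P as [|[f e] P IH]; intros t HP; simpl; [exists t; reflexivity|].
  apply over_cons in HP. destruct HP as [If HP].
  destruct (IH (act (F f) (negb e) t) HP) as [z Hz]. exists z. rewrite <- Hz.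
  symmetry; apply act_cancel', sys_std, If.
Qed.

End System.

(** * Transfer of relations *)

Section Transfer.
Variable D : list marked.
Variables FA FB : marked -> marked.
Variable T : marked -> marked -> nat -> nat.
Hypothesis HA : system D FA T.
Hypothesis HB : system D FB T.

(* Bisimulation for [k] more letters.  [similar_extra] covers bumps of [FB g] beyond the
   number of bumps of [FA g]: no other function has an end there, and they are imitated by a
   point so deep in the inner foot of the last bump of [FA g] that [k] letters cannot tell. *)
Inductive similar : nat -> R -> R -> Prop :=
| similar_0 t t' : similar 0 t t'
| similar_foot k f n e t t' : In f D -> foot (FA f) n e t -> foot (FB f) n e t' ->
    similar k (act (FA f) (negb e) t) (act (FB f) (negb e) t') -> similar (S k) t t'
| similar_extra k g n t t' : In g D -> (nb (FA g) < n)%nat ->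
    (forall j, (j <= k)%nat ->
       foot (FA g) (nb (FA g)) false (Nat.iter j (act (FA g) true) t)) ->
    inb (FB g) n t' -> similar k t t'.

Lemma similar_pred k t t' : similar (S k) t t' -> similar k t t'.
Proof.
  revert t t'. induction k as [|k IH]; intros t t' H; [apply similar_0|].
  inversion H as [|k0 f n e t0 t0' If H1 H2 H3|k0 g n t0 t0' Ig Hn Hdeep Hin]; subst.
  - apply similar_foot with f n e; auto.
  - apply similar_extra with g n; auto.
Qed.

Lemma table_le f g q : In f D -> In g D -> f <> g -> (1 <= q)%nat ->
  (T f g q <= nb (FA g))%nat.
Proof.
  intros If Ig Hne Hq. pose proof (proj2 (proj2 HA) f g q If Ig Hne Hq) as H.
  destruct (T f g q); [lia|]. apply H.
Qed.

(** Table values are realised in [FA] and so are at most [nb (FA g)], whereas a foot of [FB f] in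
    bump [n] would have table value [n]. *)
Lemma extra_no_foot f g n n' e x : In f D -> In g D -> f <> g -> (nb (FA g) < n)%nat ->
  inb (FB g) n x -> ~ foot (FB f) n' e x.
Proof.
  intros If Ig Hne Hn Hin Hfoot.
  pose proof (foot_table D FB T HB f g n' e x If Ig Hne Hfoot) as H.
  pose proof (inb_unique (FB g) _ _ x (sys_std D FB T HB g Ig) Hin H) as E.
  assert (1 <= n')%nat by (destruct Hfoot; lia).
  pose proof (table_le f g (foot_end n' e) If Ig Hne ltac:(unfold foot_end; destruct e; lia)).
  lia.
Qed.

(** In [FA g] both numbers stand for the common center. *)
Lemma extra_table f g n n' : In f D -> In g D -> g <> f ->
  (nb (FA g) < n)%nat -> (nb (FA g) < n')%nat -> T g f n = T g f n'.
Proof.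
  intros If Ig Hne Hn Hn'.
  pose proof (proj2 (proj2 HA) g f n Ig If Hne ltac:(lia)) as H.
  pose proof (proj2 (proj2 HA) g f n' Ig If Hne ltac:(lia)) as H'.
  assert (E : endp (FA g) n = endp (FA g) n').
  { pose proof (nb_pos (FA g) (sys_std D FA T HA g Ig)). unfold endp. f_equal. ixlia. }
  rewrite <- E in H'. exact (inb_unique (FA f) _ _ _ (sys_std D FA T HA f If) H H').
Qed.

(** The table is constant on extra numbers, so both ends of the bump lie in the same bump of [FB f]
    or in none. If in none, a bump of [FB f] around [x] would have part of its left foot inside the
    extra bump. *)
Lemma extra_inb f g n x : In f D -> In g D -> g <> f -> (nb (FA g) < n)%nat ->
  inb (FB g) n x -> inb (FB f) (T g f n) x.
Proof.
  intros If Ig Hne Hn Hin.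
  pose proof (sys_std D FB T HB f If) as Hf. pose proof (sys_std D FB T HB g Ig) as Hg.
  pose proof (proj2 (proj2 HB) g f n Ig If Hne ltac:(lia)) as E1.
  pose proof (proj2 (proj2 HB) g f (n + 2)%nat Ig If Hne ltac:(lia)) as E2.
  rewrite (extra_table f g (n + 2) n) in E2 by (trivial; lia).
  pose proof Hin as Hin'. apply inb_bump in Hin'; [|lia]. destruct Hin' as [Hn' Hx].
  set (i := idx (nb (FB g)) n) in *.
  assert (E : inb (FB f) (T g f n) (pt (FB g) i) /\ inb (FB f) (T g f n) (pt (FB g) (S i))).
  { unfold endp in E1, E2.
    destruct (bump_ends (nb (FB g)) n ltac:(lia)) as [[B1 [B2 _]]|[B1 [B2 _]]];
      rewrite B1 in E1; rewrite B2 in E2; split; assumption. }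
  destruct E as [Eu Ev]. clear E1 E2.
  destruct (T g f n) as [|c].
  - intros j Hj Hxj. specialize (Eu j Hj). specialize (Ev j Hj).
    assert (Hsub : pt (FB g) i <= pt (FB f) j) by lra.
    destruct (lfoot_start (FB f) j x Hf Hj ltac:(lra)) as [z [Hz Hz']].
    destruct (lfoot_foot (FB f) j z Hj Hz') as [e Hfoot].
    apply (extra_no_foot f g n (bnum (nb (FB f)) j) e z If Ig (not_eq_sym Hne) Hn); [|exact Hfoot].
    apply inb_bump; [lia|]. fold i; split; [lia|lra].
  - destruct Eu as [Hc Eu], Ev as [_ Ev]. split; [exact Hc|lra].
Qed.

(** What a letter of [f] can see: the same foot, the same bump (or none) away from all feet of [f],
    or an extra bump imitated by a deep inner foot. *)
Lemma similar_position k t t' f : similar (S k) t t' -> In f D ->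
  (exists n e, foot (FA f) n e t /\ foot (FB f) n e t' /\
     similar k (act (FA f) (negb e) t) (act (FB f) (negb e) t')) \/
  (exists n, inb (FA f) n t /\ inb (FB f) n t' /\
     (forall n' e, ~ foot (FA f) n' e t) /\ (forall n' e, ~ foot (FB f) n' e t')) \/
  (exists n, (nb (FA f) < n)%nat /\ inb (FB f) n t' /\
     forall j, (j <= S k)%nat ->
       foot (FA f) (nb (FA f)) false (Nat.iter j (act (FA f) true) t)).
Proof.
  intros H If.
  inversion H as [|k0 g n e t0 t0' Ig H1 H2 H3|k0 g n t0 t0' Ig Hn Hdeep Hin]; subst;
    destruct (classic (g = f)) as [->|Hne].
  - left; exists n, e; auto.
  - right; left. exists (T g f (foot_end n e)).
    split; [apply (foot_table D FA T HA); trivial|].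
    split; [apply (foot_table D FB T HB); trivial|].
    split; intros n' e' H'; apply Hne.
    + apply (foot_unique D FA T HA g n e f n' e' t); trivial.
    + apply (foot_unique D FB T HB g n e f n' e' t'); trivial.
  - right; right. exists n; auto.
  - right; left. exists (T g f n). pose proof (Hdeep 0%nat ltac:(lia)) as Hfoot. simpl in Hfoot.
    split; [|split; [apply extra_inb; trivial|split; intros n' e' H']].
    + rewrite (extra_table f g n (foot_end (nb (FA g)) false)); trivial.
      * apply (foot_table D FA T HA); trivial.
      * unfold foot_end; lia.
    + apply Hne. apply (foot_unique D FA T HA g _ _ f n' e' t Ig If Hfoot H').
    + exact (extra_no_foot f g n n' e' t' If Ig (not_eq_sym Hne) Hn Hin H').
Qed.

Lemma similar_push k t t' f n e : similar k t t' -> In f D ->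
  foot (FA f) n e (act (FA f) e t) -> foot (FB f) n e (act (FB f) e t') ->
  similar (S k) (act (FA f) e t) (act (FB f) e t').
Proof.
  intros H If H1 H2. apply similar_foot with f n e; trivial.
  rewrite (act_cancel (FA f)) by apply (sys_std D FA T HA f If).
  rewrite (act_cancel (FB f)) by apply (sys_std D FB T HB f If). exact H.
Qed.

(** The letter [(f, true)] uses up one level of depth in the inner foot, and [(f, false)] gains
    one. *)
Lemma similar_extra_act k f n e t t' : In f D -> (nb (FA f) < n)%nat -> inb (FB f) n t' ->
  (forall j, (j <= S k)%nat ->
     foot (FA f) (nb (FA f)) false (Nat.iter j (act (FA f) true) t)) ->
  similar k (act (FA f) e t) (act (FB f) e t').
Proof.
  intros If Hn Hin Hdeep. pose proof (sys_std D FA T HA f If) as Hf.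
  apply similar_extra with f n; trivial.
  - intros j Hj. destruct e.
    + rewrite <- Nat.iter_succ_r. apply Hdeep; lia.
    + destruct j as [|j]; [apply (foot_stays (FA f) Hf), (Hdeep 0%nat); lia|].
      rewrite Nat.iter_succ_r, (act_cancel (FA f) Hf false). apply Hdeep; lia.
  - apply act_inb; [apply (sys_std D FB T HB f If)|exact Hin].
Qed.

(** A letter costs one unit of similarity. The clause on fixed points covers the case where the
    history in [FA] does not change. *)
Lemma similar_step k t t' f e : similar (S k) t t' -> In f D ->
  similar k (act (FA f) e t) (act (FB f) e t') /\
  (act (FA f) e t = t -> act (FB f) e t' = t').
Proof.
  intros H If.
  pose proof (sys_std D FA T HA f If) as HfA. pose proof (sys_std D FB T HB f If) as HfB.
  destruct (similar_position k t t' f H If)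
    as [[n [e' [H1 [H2 H3]]]]|[[n [H1 [H2 [H3 H4]]]]|[n [Hn [Hin Hdeep]]]]].
  - split.
    + destruct (Bool.bool_dec e e') as [<-|Hne].
      * apply similar_pred, similar_pred, similar_push with n; trivial; apply foot_stays; trivial.
      * replace e with (negb e') by (destruct e, e'; simpl; congruence). exact H3.
    + intros E; exfalso.
      apply (act_moved (FA f) HfA e n t (proj1 (proj1 H1))) in E; trivial.
      apply (foot_inb _ HfA _ _ _ H1).
  - destruct n as [|n].
    + rewrite (act_fixed (FA f) HfA e t H1), (act_fixed (FB f) HfB e t' H2).
      split; [apply similar_pred, H|reflexivity].
    + split.
      * apply similar_pred, similar_pred, similar_push with (S n); trivial;
          apply foot_push; trivial; lia.
      * intros E; exfalso; apply (act_moved (FA f) HfA e (S n) t) in E; trivial; lia.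
  - split; [apply similar_extra_act with n; assumption|].
    intros E; exfalso. pose proof (Hdeep 0%nat ltac:(lia)) as H1. simpl in H1.
    apply (act_moved (FA f) HfA e _ t (proj1 (proj1 H1))) in E; trivial.
    apply (foot_inb _ HfA _ _ _ H1).
Qed.

Lemma similar_exists_extra k f n t' : In f D -> (nb (FA f) < n)%nat -> inb (FB f) n t' ->
  exists y P t, hist D FA y P t /\ similar k t t'.
Proof.
  intros If Hn Hin. pose proof (nb_pos (FA f) (sys_std D FA T HA f If)) as Hpos.
  destruct (hist_deep_in_foot D FA T HA f (nb (FA f)) false k If) as [y [P [t [H Ht]]]]; [lia|].
  exists y, P, t; split; [exact H|]. apply similar_extra with f n; trivial.
Qed.

(** The last letters of the history of [t'] are replayed in [FA], starting from a marker or, at an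
    extra bump, from a point deep in the inner foot. *)
Lemma similar_deep d t' : deep D FB (S d) t' ->
  exists y P t, hist D FA y P t /\ similar (S d) t t'.
Proof.
  revert t'. induction d as [|d IH]; intros t' [f [n [e [If [Hfoot Hd]]]]];
    pose proof (sys_std D FA T HA f If) as HfA; pose proof (sys_std D FB T HB f If) as HfB;
    (destruct (le_lt_dec n (nb (FA f))) as [Hn|Hn];
     [|apply (similar_exists_extra _ f n t' If Hn (foot_inb _ HfB _ _ _ Hfoot))]).
  - destruct (hist_push_marker D FA T HA f n e If) as [y [P [t [H Ht]]]];
      [destruct Hfoot; lia|].
    exists y, P, t; split; [exact H|]. apply similar_foot with f n e; trivial. apply similar_0.
  - destruct (IH _ Hd) as [y [P [t [H Hs]]]].
    set (t1 := act (FB f) (negb e) t') in *.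
    assert (E : t' = act (FB f) e t1) by (symmetry; apply act_cancel', HfB).
    (* The letter did push when it led from [t1] to [t']; by similarity it pushes at [t] too. *)
    assert (Hno : ~ foot (FB f) n (negb e) t1).
    { intro Hc. apply (foot_pop (FB f) HfB n e t1 Hc). rewrite <- E; exact Hfoot. }
    assert (Hin : inb (FB f) n t1) by (apply act_inb, (foot_inb _ HfB _ _ _ Hfoot); exact HfB).
    assert (Hpush : foot (FA f) n e (act (FA f) e t)).
    { destruct (similar_position d t t1 f Hs If)
        as [[n' [e' [H1 [H2 _]]]]|[[n' [H1 [H2 [H3 H4]]]]|[n' [Hn' [Hin' _]]]]].
      - assert (n' = n) as ->
          by exact (inb_unique (FB f) _ _ t1 HfB (foot_inb _ HfB _ _ _ H2) Hin).
        assert (e' = e) as ->.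
        { destruct (Bool.bool_dec e' e) as [|Hne]; [assumption|exfalso; apply Hno].
          replace (negb e) with e' by (destruct e, e'; simpl; congruence). exact H2. }
        apply foot_stays; trivial.
      - assert (n' = n) as -> by exact (inb_unique (FB f) _ _ t1 HfB H2 Hin).
        apply foot_push; trivial. destruct Hfoot; lia.
      - pose proof (inb_unique (FB f) _ _ t1 HfB Hin' Hin). lia. }
    exists y, ((f, e) :: P), (act (FA f) e t). split.
    + apply (hist_push D FA T HA) with n; trivial.
    + rewrite E. apply similar_push with n; trivial. rewrite <- E; exact Hfoot.
Qed.

(** [P] is the true history of [t] in [FA], while [t'] is only the value of the same stack in [FB]
    on some base [z]. Along [w] the two share one changing list and the bases stay. *)
Lemma similar_ev w : forall y z P t t', over D w -> hist D FA y P t -> t' = stack FB z P ->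
  similar (length w) t t' ->
  exists P', hist D FA y P' (ev FA w t) /\ ev FB w t' = stack FB z P'.
Proof.
  induction w as [|[f e] w IH]; intros y z P t t' Hw H Et Hs; simpl in *.
  - exists P; auto.
  - apply over_cons in Hw. destruct Hw as [If Hw].
    destruct (similar_step _ t t' f e Hs If) as [Hs' Hfix].
    destruct (hist_step D FA T HA y P t f e If H) as [P' [H' Hcase]].
    apply IH with (P := P'); trivial.
    destruct Hcase as [[E ->]|[_ [->| ->]]].
    + rewrite (Hfix E); exact Et.
    + rewrite Et; reflexivity.
    + rewrite Et. simpl. apply act_cancel', (sys_std D FB T HB f If).
Qed.

(** A moved point [t'] with history longer than [w] is imitated by [x] in [FA]. Since [w] fixes [x],
    the list returns to [P], and so [t'], the stack of [P] on [z], is fixed too: a contradiction. *)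
Lemma system_transfer w : over D w -> (forall t, ev FA w t = t) ->
  forall t, ev FB w t = t.
Proof.
  intros Hw HwA t. apply NNPP; intro Hne.
  destruct (moved_deep D FB T HB w t (S (length w)) Hw Hne) as [t' [Hmove Hd]].
  destruct (similar_deep (length w) t' Hd) as [y [P [x [H Hs]]]].
  destruct (stack_solve D FB T HB P t') as [z Hz]; [apply (hist_over _ _ _ _ _ H)|].
  destruct (similar_ev w y z P x t' Hw H Hz (similar_pred _ _ _ Hs)) as [P' [H' E]].
  rewrite HwA in H'.
  destruct (hist_unique D FA T HA _ _ _ _ _ H H') as [_ <-].
  apply Hmove. rewrite E, Hz. reflexivity.
Qed.

End Transfer.

(** * The isomorphism *)

Lemma ev_app F w w' t : ev F (w ++ w') t = ev F w' (ev F w t).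
Proof. revert t; induction w as [|[f e] w IH]; intros t; simpl; auto. Qed.

Definition winv (w : list letter) : list letter :=
  rev (map (fun l => (fst l, negb (snd l))) w).

Lemma winv_over D w : over D w -> over D (winv w).
Proof.
  intros H l Hl. apply in_rev, in_map_iff in Hl. destruct Hl as [l' [<- Hl']].
  exact (H l' Hl').
Qed.

Lemma over_app D w w' : over D w -> over D w' -> over D (w ++ w').
Proof. intros H H' l Hl. apply in_app_or in Hl. destruct Hl; auto. Qed.

Section Words.
Variable D : list marked.
Variable F : marked -> marked.
Hypothesis HF : forall f, In f D -> standard (F f).

Lemma ev_winv_l w t : over D w -> ev F (winv w) (ev F w t) = t.
Proof.
  revert t. induction w as [|[f e] w IH]; intros t Hw; simpl; [reflexivity|].
  apply over_cons in Hw. destruct Hw as [If Hw].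
  unfold winv. simpl. rewrite ev_app. fold (winv w). rewrite IH by exact Hw. simpl.
  apply act_cancel, HF, If.
Qed.

Lemma ev_winv_r w t : over D w -> ev F w (ev F (winv w) t) = t.
Proof.
  revert t. induction w as [|[f e] w IH]; intros t Hw; simpl; [reflexivity|].
  apply over_cons in Hw. destruct Hw as [If Hw].
  unfold winv. simpl. rewrite ev_app. fold (winv w). simpl.
  rewrite act_cancel' by (apply HF, If). apply IH, Hw.
Qed.

Lemma ev_in_gen B w : (forall f, In f D -> In (F f) B) -> over D w -> gen B (ev F w).
Proof.
  intros HB. induction w as [|[f e] w IH]; intros Hw; [apply gen_id|].
  apply over_cons in Hw. destruct Hw as [If Hw].
  change (gen B (hcomp (act (F f) e) (ev F w))). apply gen_comp; [|apply IH, Hw].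
  pose proof (gen_base B (F f) (HB f If)) as Hb.
  destruct e; [exact Hb|]. apply (gen_inv B (mfun (F f))); [exact Hb| |]; intros t.
  - apply (act_cancel (F f) (HF f If) true).
  - apply (act_cancel (F f) (HF f If) false).
Qed.

Lemma gen_is_ev B h : (forall g, In g B -> exists f, In f D /\ F f = g) -> gen B h ->
  exists w, over D w /\ forall t, ev F w t = h t.
Proof.
  intros HB. induction 1 as [|g Ig|h k _ [w [Hw E]] _ [w' [Hw' E']]|h k _ [w [Hw E]] Hkh Hhk].
  - exists []; split; [intros l []|reflexivity].
  - destruct (HB g Ig) as [f [If <-]]. exists [(f, true)]; split; [|reflexivity].
    intros l [<-|[]]; exact If.
  - exists (w ++ w'); split; [apply over_app; assumption|].
    intros t. rewrite ev_app, E, E'. reflexivity.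
  - exists (winv w); split; [apply winv_over, Hw|].
    intros t. rewrite <- (Hhk t) at 1. rewrite <- E. apply ev_winv_l, Hw.
Qed.
End Words.

Lemma system_transfer_eq D FA FB T w w' : system D FA T -> system D FB T ->
  over D w -> over D w' -> (forall t, ev FA w t = ev FA w' t) ->
  forall t, ev FB w t = ev FB w' t.
Proof.
  intros HA HB Hw Hw' E t.
  assert (H : forall t, ev FB (w ++ winv w') t = t).
  { apply (system_transfer D FA FB T HA HB).
    - apply over_app; [exact Hw|apply winv_over, Hw'].
    - intros s. rewrite ev_app, E. apply (ev_winv_l D FA); [apply HA|exact Hw']. }
  rewrite <- (H t) at 2. rewrite ev_app. symmetry.
  apply (ev_winv_r D FB); [apply HB|exact Hw'].
Qed.

(** The bump of [g] containing end [q] of [f]: the branches are the two halves of [linked], for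
    [f < g] and for [g < f]. *)
Definition osc_table (f g : marked) (q : nat) : nat :=
  if excluded_middle_informative (slt f g) then Nat.min q (osc f g)
  else Nat.min (q - 2) (osc g f - 1).

(** The table depends on the order and oscillations of the indices alone, so families that agree in
    these share it. *)
Lemma osc_table_system D F :
  (forall f, In f D -> standard (F f)) ->
  (forall f g, In f D -> In g D -> f <> g -> F f <> F g) ->
  (forall f g, In f D -> In g D -> f <> g -> slt f g \/ slt g f) ->
  (forall f g, In f D -> In g D -> f <> g -> slt f g -> std_pair (F f) (F g)) ->
  (forall f g, In f D -> In g D -> slt f g -> osc (F f) (F g) = osc f g) ->
  system D F osc_table.
Proof.
  intros Hstd Hinj Htot Hpair Hosc. split; [exact Hstd|split].
  - intros f g If Ig Hne.
    destruct (Htot f g If Ig Hne) as [H|H].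
    + destruct (std_pair_standard _ _ (Hpair f g If Ig Hne H)) as [_ [_ Hfast]].
      apply fast_feet_disjoint; auto.
    + destruct (std_pair_standard _ _ (Hpair g f Ig If (not_eq_sym Hne) H)) as [_ [_ Hfast]].
      pose proof (fast_feet_disjoint (F g) (F f) (Hstd g Ig) (Hstd f If)
        (Hinj g f Ig If (not_eq_sym Hne)) Hfast) as Hd.
      intros i j x Hi Hj Hx Hx'. exact (Hd j i x Hj Hi Hx' Hx).
  - intros f g q If Ig Hne Hq. unfold osc_table.
    destruct (excluded_middle_informative (slt f g)) as [H|H].
    + rewrite <- (Hosc f g If Ig H). apply std_pair_link; auto.
    + destruct (Htot f g If Ig Hne) as [H'|H']; [contradiction|].
      rewrite <- (Hosc g f Ig If H').
      apply (std_pair_link (F g) (F f)); auto.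
Qed.

Theorem theorem1p3 (A B : list marked) (theta : marked -> marked) :
  in_S A -> in_S B ->
  length A = length B ->
  (forall f, In f A -> In (theta f) B) ->
  (forall f g, In f A -> In g A -> theta f = theta g -> f = g) ->
  (forall g', In g' B -> exists f, In f A /\ theta f = g') ->
  (forall f g, In f A -> In g A -> slt f g -> slt (theta f) (theta g)) ->
  (forall f g, In f A -> In g A -> slt f g ->
     osc (theta f) (theta g) = osc f g) ->
  exists phi : (R -> R) -> (R -> R),
    (forall h, gen A h -> gen B (phi h)) /\
    (forall h k, gen A h -> gen A k -> phi (hcomp h k) = hcomp (phi h) (phi k)) /\
    (forall h k, gen A h -> gen A k -> phi h = phi k -> h = k) /\
    (forall k, gen B k -> exists h, gen A h /\ phi h = k) /\
    (forall f, In f A -> phi (mfun f) = mfun (theta f)).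
Proof.
  intros [_ [SA [TA PA]]] [_ [SB [_ PB]]] _ Hin Hinj Hsurj Hmono Hosc.
  (* Both families are indexed by [A], through the identity and through [theta]. *)
  set (id_ := fun f : marked => f).
  assert (SysA : system A id_ osc_table) by (apply osc_table_system; auto).
  assert (SysB : system A theta osc_table)
    by (apply osc_table_system; auto).
  set (word := fun h => epsilon (inhabits (@nil letter))
                          (fun w => over A w /\ forall t, ev id_ w t = h t)).
  assert (Hword : forall h, gen A h -> over A (word h) /\ forall t, ev id_ (word h) t = h t).
  { intros h Hh. unfold word. apply epsilon_spec.
    apply (gen_is_ev A id_ SA A h); [|exact Hh]. intros g Ig; exists g; auto. }
  set (phi := fun h => ev theta (word h)).
  (* Transfer from [A] to [B] makes [phi] independent of the word chosen by [epsilon]. *)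
  assert (Hphi : forall w h, gen A h -> over A w -> (forall t, ev id_ w t = h t) ->
            phi h = ev theta w).
  { intros w h Hh Hw E. destruct (Hword h Hh) as [H1 H2].
    apply functional_extensionality.
    apply (system_transfer_eq A id_ theta osc_table); trivial.
    intros t. rewrite H2, E. reflexivity. }
  exists phi. repeat split.
  - intros h Hh. apply (ev_in_gen A theta); [apply SysB|exact Hin|apply Hword, Hh].
  - intros h k Hh Hk. destruct (Hword h Hh) as [Oh Eh]. destruct (Hword k Hk) as [Ok Ek].
    rewrite (Hphi (word h ++ word k)).
    + apply functional_extensionality; intros t. apply ev_app.
    + apply gen_comp; assumption.
    + apply over_app; assumption.
    + intros t. rewrite ev_app, Eh, Ek. reflexivity.
  - intros h k Hh Hk E. destruct (Hword h Hh) as [Oh Eh]. destruct (Hword k Hk) as [Ok Ek].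
    apply functional_extensionality; intros t. rewrite <- Eh, <- Ek.
    (* Injectivity is the transfer in the opposite direction, from [B] to [A]. *)
    apply (system_transfer_eq A theta id_ osc_table); trivial.
    intros s. exact (f_equal (fun u => u s) E).
  - intros k Hk. destruct (gen_is_ev A theta (proj1 SysB) B k Hsurj Hk) as [w [Hw E]].
    assert (Hg : gen A (ev id_ w)) by (apply (ev_in_gen A id_); auto).
    exists (ev id_ w); split; [exact Hg|]. rewrite (Hphi w) by auto.
    apply functional_extensionality, E.
  - intros f If. rewrite (Hphi [(f, true)]); trivial.
    + apply gen_base, If.
    + intros l [<-|[]]; exact If.
Qed.
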